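(* For Lebesgue-almost every $\alpha>0$ the following holds: for every $\varepsilon>0$ there is a constant $C=C(\alpha,\varepsilon)>0$ such that $\delta_{\min}^{(\alpha)}(N)\le C\,N^{-1+\varepsilon}$ for all integers $N\ge 2$.
   Context: For irrational $\alpha>0$, the numbers $\alpha m^2+n^2$ with integers $m,n\ge 1$ are pairwise distinct; list them in increasing order as $0<\lambda_1<\lambda_2<\cdots$. For $N\ge 2$ define the minimal gap $\delta_{\min}^{(\alpha)}(N)=\min\{\lambda_{i+1}-\lambda_i : 1\le i<N\}$. (Almost every $\alpha$ is irrational, so this is defined for almost every $\alpha$.) *)

(* Defs.v *)
From HB Require Import structures.
From mathcomp Require Import all_boot all_order all_algebra.
From mathcomp Require Import all_classical all_reals all_analysis.
Set Implicit Arguments. Unset Strict Implicit. Unset Printing Implicit Defensive.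
Import Order.TTheory GRing.Theory Num.Theory.
Local Open Scope classical_set_scope.
Local Open Scope ring_scope.

Definition spec_set (R : realType) (alpha : R) : set R :=
  [set x | exists m n : nat, [/\ (0 < m)%N, (0 < n)%N &
                              x = alpha * (m%:R) ^+ 2 + (n%:R) ^+ 2]].

(* lam lists the set in increasing order, 0-indexed: lam i = lambda_{i+1}. *)
Definition increasing_enum (R : realType) (alpha : R) (lam : nat -> R) : Prop :=
  (forall i, lam i < lam i.+1) /\ range lam = spec_set alpha.

(* delta_min(N) = min_{1 <= i < N} (lambda_{i+1} - lambda_i)
   = min_{0 <= j < N-1} (lam (j+1) - lam j)  (the seed is the j = 0 term,
   so for N >= 2 this is exactly that minimum). *)
Definition delta_min (R : realType) (lam : nat -> R) (N : nat) : R :=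
  \big[Num.min/(lam 1%N - lam 0%N)]_(j < N.-1) (lam j.+1 - lam j).

(* Main.v *)
Require Import Defs.
From HB Require Import structures.
From mathcomp Require Import all_boot all_order all_algebra.
From mathcomp Require Import all_classical all_reals all_analysis.
From mathcomp Require Import ring lra zify.
Import Order.TTheory GRing.Theory Num.Theory.
Import numFieldNormedType.Exports.
Local Open Scope classical_set_scope.
Local Open Scope ring_scope.

(** For [m1 = a + b], [m2 = a - b], [n1 = c + d], [n2 = c - d] the two eigenvalues
    [al m1^2 + n2^2] and [al m2^2 + n1^2] differ by [4 (al a b - c d)], so small gaps come
    from rationals [c d / (a b)] very close to [al].  Let [a, b, c, d] have size [M] and
    multiply [a] by one more integer [u] of size [L = M^o(1)]; a rational within
    [M^(-4+o(1))] of [al] is wanted.  Put [log2 al] on the circle R/Z, discretised as Z/J, so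
    that multiplication of [al] by [u] becomes a translation and powers of 2 are harmless.
    In L^2(Z/J) the average of the translations by [log2 u], [L <= u < 2 L], nearly
    annihilates the difference of the smoothings of a function at two consecutive scales
    [b^(-j)], [b^(-j-1)] below about [1 / L]: this is Weyl differencing carried out directly
    on translations, where the k-th differences of [log2 u] are almost arithmetic
    progressions whose steps fit the scale.  The number of representations [c d / (a b)] has
    L^2 norm bounded through the divisor bound and has the expected density at the coarse
    scale because [d] alone equidistributes there.  Hence by Chebyshev all but a proportion
    [O(2^-n)] of the [al] admit a solution at the scale indexed by [n], and Borel-Cantelli
    concludes. *)

(** * Translations and van der Corput's inequality in L^2 of a finite group *)

(** At the precision used, an arc of [l] cells out of [J = rho^4 M^4 l] expects only about [rho^-4]
    of the quadruples [(a, b, c, d)], and the available bound on the second moment exceeds the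
    square of the mean by a factor of order [D^4 rho^4], with [D] a bound for the divisor function.
    Chebyshev applied to the quadruples alone therefore says nothing, and averaging over the
    multipliers has to gain a fixed power of [rho]: the gain in norm is [th = rho^-8], on each of at
    most [4 m] bands of scales. Each differencing lowers the step of the progression by a factor of
    about [b^p], so that [k] differencings serve [p] consecutive scales and at most [K = 4 m / p] of
    them are needed. The order of the choices matters: epsilon fixes [p], then [m = p^2], [K = 4 p]
    and [r = 9 p + 5], so that [L = b^r] is [M] to a power of order [1 / p]. Only [b] grows
    afterwards, while the number of bands and the number of square roots lost to differencing stay
    bounded. *)

Section L2.
Context {R : realType} {V : finZmodType}.
Implicit Types (f g : V -> R) (s t : V).

Definition dot f g : R := \sum_x f x * g x.
Definition nrm f : R := Num.sqrt (dot f f).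

Lemma dot_ge0 f : 0 <= dot f f.
Proof. by apply: sumr_ge0 => x _; rewrite -expr2 sqr_ge0. Qed.

Lemma nrm_ge0 f : 0 <= nrm f.
Proof. exact: sqrtr_ge0. Qed.

Lemma sqr_nrm f : nrm f ^+ 2 = dot f f.
Proof. by rewrite sqr_sqrtr // dot_ge0. Qed.

Lemma dotC f g : dot f g = dot g f.
Proof. by apply: eq_bigr => x _; rewrite mulrC. Qed.

Lemma dotDl f1 f2 g : dot (f1 + f2) g = dot f1 g + dot f2 g.
Proof. by rewrite -big_split; apply: eq_bigr => x _; exact: mulrDl. Qed.

Lemma dotZl a f g : dot (a *: f) g = a * dot f g.
Proof. by rewrite mulr_sumr; apply: eq_bigr => x _; exact: esym (mulrA _ _ _). Qed.

Lemma dot0l g : dot 0 g = 0.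
Proof. by apply: big1 => x _; exact: mul0r. Qed.

Lemma dot_suml I (r : seq I) (F : I -> V -> R) g :
  dot (\sum_(i <- r) F i) g = \sum_(i <- r) dot (F i) g.
Proof. by elim/big_ind2: _ => [|x a y b <- <-|//]; rewrite ?dot0l ?dotDl. Qed.

Lemma dot_sumr I (r : seq I) (F : I -> V -> R) g :
  dot g (\sum_(i <- r) F i) = \sum_(i <- r) dot g (F i).
Proof. by rewrite dotC dot_suml; apply: eq_bigr => i _; rewrite dotC. Qed.

Lemma dot_nrm_le0 f g : nrm f <= 0 -> dot f g = 0.
Proof.
move=> f0; have ff : dot f f = 0.
  have n0 : nrm f = 0 by apply/eqP; rewrite eq_le f0 nrm_ge0.
  by rewrite -sqr_nrm n0 expr0n.
rewrite /dot big1 // => x _.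
have /eqP := ff; rewrite psumr_eq0 => [/allP/(_ x (mem_index_enum _))|y _].
  by rewrite mulf_eq0 orbb => /eqP ->; rewrite mul0r.
by rewrite -expr2 sqr_ge0.
Qed.

(** Cauchy-Schwarz, by expanding the squared norm of [nrm g *: f - nrm f *: g]. *)
Lemma dot_le_nrm f g : dot f g <= nrm f * nrm g.
Proof.
have [f0|f_gt0] := leP (nrm f) 0.
  by rewrite dot_nrm_le0 // mulr_ge0 // nrm_ge0.
have [g0|g_gt0] := leP (nrm g) 0.
  by rewrite dotC dot_nrm_le0 // mulr_ge0 // nrm_ge0.
have := dot_ge0 (nrm g *: f + (- nrm f) *: g).
rewrite dotDl !dotZl ![dot _ (_ + _)]dotC !dotDl !dotZl (dotC g f) -!sqr_nrm => h.
have h2 : 0 <= (nrm f * nrm g) * (nrm f * nrm g - dot f g) by nra.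
by rewrite pmulr_rge0 ?subr_ge0 // mulr_gt0 in h2.
Qed.

Lemma nrmD f g : nrm (f + g) <= nrm f + nrm g.
Proof.
rewrite -(@ler_pXn2r _ 2) ?nnegrE ?addr_ge0 ?nrm_ge0 //.
rewrite sqr_nrm dotDl ![dot _ (f + g)]dotC !dotDl (dotC g f) sqrrD !sqr_nrm.
by have := dot_le_nrm f g; lra.
Qed.

Lemma nrmZ a f : nrm (a *: f) = `|a| * nrm f.
Proof.
by rewrite /nrm dotZl dotC dotZl mulrA -expr2 sqrtrM ?sqr_ge0 // sqrtr_sqr.
Qed.

Lemma nrmN f : nrm (- f) = nrm f.
Proof. by rewrite -scaleN1r nrmZ normrN1 mul1r. Qed.

Lemma nrm0 : nrm 0 = 0.
Proof. by rewrite -[0](scale0r 0) nrmZ normr0 mul0r. Qed.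

Lemma nrmB f g : nrm (f - g) <= nrm f + nrm g.
Proof. by rewrite -(nrmN g) nrmD. Qed.

Lemma nrmBC f g : nrm (f - g) = nrm (g - f).
Proof. by rewrite -nrmN opprB. Qed.

Lemma nrm_trans g f h : nrm (f - h) <= nrm (f - g) + nrm (g - h).
Proof. by have := nrmD (f - g) (g - h); rewrite addrA subrK. Qed.

Lemma nrm_sum I (r : seq I) (P : pred I) (F : I -> V -> R) :
  nrm (\sum_(i <- r | P i) F i) <= \sum_(i <- r | P i) nrm (F i).
Proof.
elim/big_ind2: _ => [|f a g b fa gb|//]; first by rewrite nrm0.
by rewrite (le_trans (nrmD _ _)) // lerD.
Qed.

Lemma nrm_sum_le n (F : 'I_n -> V -> R) c :
  (forall i, nrm (F i) <= c) -> nrm (\sum_i F i) <= n%:R * c.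
Proof.
move=> Fc; apply: (le_trans (nrm_sum _ _ _ _)).
apply: (@le_trans _ _ (\sum_(i < n) c)); first exact: ler_sum.
by rewrite sumr_const card_ord mulr_natl.
Qed.

Definition trans s f : V -> R := fun x => f (x + s).

Lemma transB s f g : trans s (f - g) = trans s f - trans s g.
Proof. by []. Qed.

Lemma transZ s a f : trans s (a *: f) = a *: trans s f.
Proof. by []. Qed.

Lemma trans_sum s I (r : seq I) (F : I -> V -> R) :
  trans s (\sum_(i <- r) F i) = \sum_(i <- r) trans s (F i).
Proof. by elim/big_ind2: _ => // f1 f2 g1 g2 <- <-. Qed.

Lemma trans_trans s t f : trans s (trans t f) = trans (s + t) f.
Proof. by apply/funext => x; rewrite /trans addrA. Qed.

Lemma dot_trans s f g : dot (trans s f) (trans s g) = dot f g.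
Proof. by rewrite /dot [RHS](reindex_inj (addIr s)). Qed.

Lemma dot_transC s t f : dot (trans s f) (trans t f) = dot (trans (s - t) f) f.
Proof. by rewrite -[RHS](dot_trans t) trans_trans addrC subrK. Qed.

Lemma nrm_trans_op s f : nrm (trans s f) = nrm f.
Proof. by rewrite /nrm dot_trans. Qed.

Definition tsum n (sg : nat -> V) f : V -> R := \sum_(u < n) trans (sg u) f.

Lemma nrm_tsum n sg f : nrm (tsum n sg f) <= n%:R * nrm f.
Proof. by apply: nrm_sum_le => i; rewrite nrm_trans_op. Qed.

Lemma sqr_nrm_tsum n sg f :
  nrm (tsum n sg f) ^+ 2 = \sum_(u < n) \sum_(v < n) dot (trans (sg u - sg v) f) f.
Proof.
rewrite sqr_nrm dot_suml; apply: eq_bigr => u _.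
by rewrite dot_sumr; apply: eq_bigr => v _; rewrite dot_transC.
Qed.

(** Negating all shifts gives the adjoint of a normal operator. It allows progressions with negative
    step to be reversed. *)
Lemma nrm_tsumN n sg f : nrm (tsum n (fun u => - sg u) f) = nrm (tsum n sg f).
Proof.
apply/eqP; rewrite -(@eqrXn2 _ 2) ?nrm_ge0 //; apply/eqP.
rewrite !sqr_nrm_tsum exchange_big; apply: eq_bigr => u _; apply: eq_bigr => v _.
by rewrite opprK addrC.
Qed.

Lemma sum_shiftB (F : nat -> V -> R) n h c : (forall i, nrm (F i) <= c) ->
  nrm (\sum_(u < n) F (u + h)%N - \sum_(u < n) F u) <= 2 * h%:R * c.
Proof.
move=> Fc.
have -> : \sum_(u < n) F (u + h)%N - \sum_(u < n) F u
    = \sum_(u < h) F (n + u)%N - \sum_(u < h) F u.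
  have e1 : \sum_(u < n) F u + \sum_(u < h) F (n + u)%N = \sum_(u < n + h) F u.
    by rewrite big_split_ord.
  have e2 : \sum_(u < h) F u + \sum_(u < n) F (u + h)%N = \sum_(u < n + h) F u.
    rewrite addnC big_split_ord; congr (_ + _).
    by apply: eq_bigr => u _; rewrite addnC.
  rewrite -[X in X - _ = _](addKr (\sum_(u < h) F u)) e2.
  rewrite -[X in _ = X - _](addKr (\sum_(u < n) F u)) e1.
  by rewrite ![- _ + _]addrC addrAC.
apply: (le_trans (nrmB _ _)).
by rewrite -mulrA mulr_natl mulr2n lerD // nrm_sum_le.
Qed.

(** The sum over [u] is compared with its mean over [H] shifts of the index. Cauchy-Schwarz over [u]
    then leaves correlations of two translates of [f], which depend on the differences of [sg] only.
    The number [q] is the relative size of the differenced sums; its square root is what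
    survives. *)
Lemma van_der_corput n H (sg : nat -> V) f B q : (0 < H)%N -> nrm f <= B -> 0 <= q ->
  \sum_(h < H) \sum_(h' < H) nrm (tsum n (fun u => sg (u + h)%N - sg (u + h')%N) f)
    <= H%:R ^+ 2 * n%:R * q * B ->
  nrm (tsum n sg f) <= (2 * H%:R + n%:R * Num.sqrt q) * B.
Proof.
move=> H0 fB q0 hq.
have B0 : 0 <= B := le_trans (nrm_ge0 f) fB.
have H0' : 0 < H%:R :> R by rewrite ltr0n.
pose F u := trans (sg u) f.
pose S := tsum n sg f.
pose W := \sum_(h < H) \sum_(u < n) F (u + h)%N.
have WS : nrm (H%:R *: S - W) <= H%:R * (2 * H%:R * B).
  have -> : H%:R *: S - W = \sum_(h < H) (S - \sum_(u < n) F (u + h)%N).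
    by rewrite sumrB sumr_const card_ord scaler_nat.
  apply: nrm_sum_le => h; rewrite nrmBC.
  apply: (le_trans (@sum_shiftB F n h B _)) => [i|]; first by rewrite nrm_trans_op.
  by rewrite ler_wpM2r // ler_wpM2l // ler_nat ltnW.
have WB : nrm W <= H%:R * n%:R * Num.sqrt q * B.
  rewrite -(@ler_pXn2r _ 2) ?nnegrE ?nrm_ge0 ?mulr_ge0 ?sqrtr_ge0 //.
  have -> : (H%:R * n%:R * Num.sqrt q * B) ^+ 2 = n%:R * (H%:R ^+ 2 * n%:R * q * B * B).
    by rewrite !exprMn sqr_sqrtr //; ring.
  have -> : W = \sum_(u < n) \sum_(h < H) F (u + h)%N by rewrite /W exchange_big.
  pose G (u : 'I_n) := \sum_(h < H) F (u + h)%N.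
  have h1 : nrm (\sum_u G u) ^+ 2 <= n%:R * \sum_u nrm (G u) ^+ 2.
    rewrite sqr_nrm dot_suml.
    under eq_bigr do rewrite dot_sumr.
    have h2 (u v : 'I_n) : dot (G u) (G v) <= 2^-1 * nrm (G u) ^+ 2 + 2^-1 * nrm (G v) ^+ 2.
      have := dot_le_nrm (G u) (G v).
      by have := sqr_ge0 (nrm (G u) - nrm (G v)); nra.
    apply: (@le_trans _ _ (\sum_(u < n) \sum_(v < n)
        (2^-1 * nrm (G u) ^+ 2 + 2^-1 * nrm (G v) ^+ 2))).
      by apply: ler_sum => u _; apply: ler_sum => v _.
    set A := \sum_u nrm (G u) ^+ 2.
    have hs u : \sum_(v < n) (2^-1 * nrm (G u) ^+ 2 + 2^-1 * nrm (G v) ^+ 2)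
        = n%:R * 2^-1 * nrm (G u) ^+ 2 + 2^-1 * A.
      by rewrite big_split /= sumr_const card_ord -[X in X + _]mulr_natl -mulr_sumr mulrA.
    under eq_bigr do rewrite hs.
    rewrite big_split /= sumr_const card_ord -mulr_sumr -[X in _ + X]mulr_natl -/A; lra.
  apply: (le_trans h1); rewrite ler_wpM2l //.
  have -> : \sum_u nrm (G u) ^+ 2 =
     \sum_(h < H) \sum_(h' < H) dot (tsum n (fun u => sg (u + h)%N - sg (u + h')%N) f) f.
    transitivity (\sum_(u < n) \sum_(h < H) \sum_(h' < H)
        dot (trans (sg (u + h)%N - sg (u + h')%N) f) f).
      by apply: eq_bigr => u _; rewrite (sqr_nrm_tsum _ (fun h => sg (u + h)%N)).
    rewrite exchange_big; apply: eq_bigr => h _.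
    by rewrite exchange_big; apply: eq_bigr => h' _; rewrite dot_suml.
  apply: (@le_trans _ _ ((H%:R ^+ 2 * n%:R * q * B) * B)) => //.
  apply: (le_trans _ (ler_wpM2r B0 hq)).
  rewrite mulr_suml; apply: ler_sum => h _; rewrite mulr_suml; apply: ler_sum => h' _.
  by apply: (le_trans (dot_le_nrm _ _)); rewrite ler_wpM2l ?nrm_ge0.
rewrite -(ler_pM2l H0').
have -> : H%:R * nrm S = nrm (H%:R *: S) by rewrite nrmZ ger0_norm.
have := nrmD (H%:R *: S - W) W; rewrite subrK => h.
by apply: (le_trans h); nra.
Qed.

End L2.

(** * Iterated differencing, smoothings and progressions of translations *)

Section Weyl.
Context {R : realType} {V : finZmodType}.
Implicit Types (f g : V -> R).

(** A difference is taken between two shifts [h] and [h'], not between a shift and 0, because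
    [van_der_corput] yields a double sum over shifts. *)
Fixpoint mdiff {W : zmodType} (sg : nat -> W) (hs : seq (nat * nat)) : nat -> W :=
  if hs is (h, h') :: hs' then mdiff (fun u => sg (u + h)%N - sg (u + h')%N) hs'
  else sg.

Lemma count_interval n a b (P : pred nat) :
  (forall i, P i -> (a <= i < b)%N) -> (count P (iota 0 n) <= b - a)%N.
Proof.
move=> hP; rewrite -size_filter -(size_iota a (b - a)).
apply: uniq_leq_size; first by rewrite filter_uniq ?iota_uniq.
move=> i; rewrite mem_filter mem_iota => /andP[/hP /andP[ai ib] _].
by rewrite mem_iota ai /=; lia.
Qed.

Lemma sum_good_bad n a b (P : pred nat) (F : nat -> R) (x y : R) :
  0 <= x -> 0 <= y ->
  (forall i, P i -> (a <= i < b)%N) ->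
  (forall i, (i < n)%N -> P i -> F i <= y) ->
  (forall i, (i < n)%N -> ~~ P i -> F i <= x) ->
  \sum_(i < n) F i <= n%:R * x + (b - a)%:R * y.
Proof.
move=> x0 y0 hP Fy Fx.
apply: (@le_trans _ _ (\sum_(i < n) (x + (P i)%:R * y))).
  apply: ler_sum => i _; case: (boolP (P i)) => Pi.
    by rewrite mul1r ler_wpDl // Fy.
  by rewrite mul0r addr0 Fx.
rewrite big_split /= sumr_const card_ord -[X in X + _ <= _]mulr_natl lerD2l -mulr_suml ler_wpM2r //.
rewrite -natr_sum ler_nat -(big_mkord xpredT (fun i => nat_of_bool (P i))).
rewrite (eq_bigr (fun i => if P i then 1 else 0)%N) => [|i _]; last by case: (P i).
by rewrite -big_mkcond sum1_count /index_iota subn0 count_interval.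
Qed.

(** Shifts closer than [H0] would make the product of the [h - h'], and with it the step of the
    progression, too small. Such pairs are rare and receive the trivial bound. *)
Definition spread H H0 (p : nat * nat) : bool :=
  [&& p.1 < H, p.2 < H & (p.1 + H0 <= p.2) || (p.2 + H0 <= p.1)]%N.

(* Each of the [k] applications of van der Corput's inequality takes a square root
   of the saving, whence the exponent [2 ^ (K - k)] *)
Lemma weyl_iter n H H0 K (th B : R) f k (sg : nat -> V) :
  (0 < H)%N -> 0 <= th <= 1 -> nrm f <= B ->
  H%:R <= n%:R * th ^+ (2 ^ K) -> 2 * H0%:R <= H%:R * th ^+ (2 ^ K) ->
  (k <= K)%N ->
  (forall hs, size hs = k -> all (spread H H0) hs ->
     nrm (tsum n (mdiff sg hs) f) <= n%:R * th ^+ (2 ^ K) * B) ->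
  nrm (tsum n sg f) <= 9 * n%:R * th ^+ (2 ^ (K - k)) * B.
Proof.
move=> H_gt0 /andP[th0 th1] fB HU H0H.
have B0 : 0 <= B := le_trans (nrm_ge0 f) fB.
have thE e : 0 <= th ^+ e by rewrite exprn_ge0.
have thK j : th ^+ (2 ^ K) <= th ^+ (2 ^ (K - j)).
  by rewrite ler_wiXn2l // leq_exp2l // leq_subr.
have triv s : nrm (tsum n s f) <= n%:R * B.
  by apply: (le_trans (nrm_tsum _ _ _)); rewrite ler_wpM2l.
elim: k sg => [|k IH] sg kK hyp.
  rewrite subn0; apply: (le_trans (hyp [::] erefl isT)).
  have := mulr_ge0 (mulr_ge0 (ler0n _ n) (thE (2 ^ K)%N)) B0; lra.
set P := th ^+ (2 ^ (K - k.+1)).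
have PQ : th ^+ (2 ^ (K - k)) = P ^+ 2.
  by rewrite -exprM; congr (_ ^+ _); rewrite -expnSr; congr (2 ^ _)%N; lia.
have P0 : 0 <= P by exact: thE.
have P1 : P <= 1 by rewrite /P exprn_ile1.
(* The constant 9 reproduces itself: spread pairs contribute [9 P^2] and close pairs [P^2], the root
   of 10 is at most 4, and [2 H] adds [2 n P], for a total of [6 n P]. *)
apply: (@le_trans _ _ ((2 * H%:R + n%:R * Num.sqrt (10 * P ^+ 2)) * B)); last first.
  rewrite ler_wpM2r //.
  have s10 : Num.sqrt (10 * P ^+ 2) <= 4 * P.
    rewrite -[leRHS]ger0_norm ?mulr_ge0 // -sqrtr_sqr ler_sqrt.
      by nra.
    by rewrite sqr_ge0.
  have h1 := ler_wpM2l (ler0n R n) s10.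
  have h2 := ler_wpM2l (ler0n R n) (thK k.+1).
  have h3 := mulr_ge0 (ler0n R n) P0.
  rewrite -/P in h2; nra.
apply: van_der_corput => //; first by rewrite mulr_ge0 // sqr_ge0.
apply: (@le_trans _ _ (\sum_(h < H) (H%:R * (9 * n%:R * P ^+ 2 * B) + 2 * H0%:R * (n%:R * B)))).
  apply: ler_sum => h _.
  pose Pb i := ((h < i + H0) && (i < h + H0))%N.
  have -> : 2 * H0%:R = (h + H0 - (h - H0) + ((H0 - h)))%:R :> R by rewrite -natrM; congr _%:R; lia.
  apply: (@le_trans _ _ (H%:R * (9 * n%:R * P ^+ 2 * B) + (h + H0 - (h - H0))%:R * (n%:R * B))); last first.
    by rewrite lerD2l ler_wpM2r ?mulr_ge0 // ler_nat leq_addr.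
  apply: (@sum_good_bad _ _ _ Pb (fun h' => nrm (tsum n (fun u => sg (u + h)%N - sg (u + h')%N) f))).
  - by rewrite !mulr_ge0 // sqr_ge0.
  - by rewrite mulr_ge0.
  - by move=> i /andP[]; lia.
  - by move=> i _ _; exact: triv.
  move=> i iH Pi; rewrite -PQ; apply: IH; first exact: ltnW.
  move=> hs hsk hsg; apply: (hyp ((h : nat, i) :: hs)); first by rewrite /= hsk.
  rewrite /= hsg andbT /spread /= ltn_ord iH /=.
  by move: Pi; rewrite /Pb negb_and -!leqNgt orbC.
rewrite sumr_const card_ord -mulr_natl.
have h1 : 0 <= H%:R * n%:R * B by rewrite !mulr_ge0.
have h2 : 2 * H0%:R * (n%:R * B) * H%:R <= H%:R ^+ 2 * n%:R * P ^+ 2 * B.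
  have -> : H%:R ^+ 2 * n%:R * P ^+ 2 * B = H%:R * P ^+ 2 * (H%:R * n%:R * B) by ring.
  have -> : 2 * H0%:R * (n%:R * B) * H%:R = 2 * H0%:R * (H%:R * n%:R * B) by ring.
  rewrite ler_wpM2r // -PQ; apply: (le_trans H0H); rewrite ler_wpM2l //.
nra.
Qed.

Lemma mdiff_morph {W W' : zmodType} (phi : {additive W -> W'}) (sg : nat -> W) hs u :
  mdiff (phi \o sg) hs u = phi (mdiff sg hs u).
Proof.
elim: hs sg u => [//|[h h'] hs IH] sg u /=; rewrite -IH.
by congr (mdiff _ hs u); apply/funext => v; rewrite /= raddfB.
Qed.

(** Controls the rounding of logarithms to integers: each differencing doubles the error. *)
Lemma mdiff_dist (a b : nat -> R) hs u :
  (forall u, `|a u - b u| <= 1) -> `|mdiff a hs u - mdiff b hs u| <= 2 ^+ size hs.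
Proof.
suff gen c : (forall u, `|a u - b u| <= c) -> `|mdiff a hs u - mdiff b hs u| <= 2 ^+ size hs * c.
  by move=> /gen; rewrite mulr1.
elim: hs a b c u => [|[h h'] hs IH] a b c u ab /=; first by rewrite mul1r ab.
rewrite exprSr -mulrA; apply: IH => v.
have := ab (v + h)%N; have := ab (v + h')%N; rewrite !ler_norml => /andP[? ?] /andP[? ?].
by apply/andP; split; lra.
Qed.

Variable one : V.

(** A one-sided box is used as smoothing kernel because boxes tile, which makes [ap_avg] an exact
    identity. *)
Definition avg l f : V -> R := l%:R^-1 *: tsum l (fun y => one *+ y) f.

Lemma tsumE n (s : nat -> V) f x : tsum n s f x = \sum_(u < n) f (x + s u).
Proof. by rewrite /tsum; elim/big_ind2: _ => // ? ? ? ? <- <-. Qed.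

Lemma avgE l f x : avg l f x = l%:R^-1 * \sum_(y < l) f (x + one *+ y).
Proof. by rewrite -(tsumE _ (fun y => one *+ y)). Qed.

Lemma tsumD n (sg : nat -> V) f g : tsum n sg (f + g) = tsum n sg f + tsum n sg g.
Proof. by rewrite -big_split. Qed.

Lemma tsumZ n (sg : nat -> V) a f : tsum n sg (a *: f) = a *: tsum n sg f.
Proof. by rewrite scaler_sumr; apply: eq_bigr. Qed.

Lemma tsumB n (sg : nat -> V) f g : tsum n sg (f - g) = tsum n sg f - tsum n sg g.
Proof. by rewrite tsumD -[- g]scaleN1r tsumZ scaleN1r. Qed.

Lemma tsumC n m (sg tau : nat -> V) f : tsum n sg (tsum m tau f) = tsum m tau (tsum n sg f).
Proof.
rewrite /tsum; under eq_bigr do rewrite trans_sum.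
rewrite exchange_big; apply: eq_bigr => u _; rewrite trans_sum; apply: eq_bigr => v _.
by rewrite !trans_trans addrC.
Qed.

Lemma avgZ l a f : avg l (a *: f) = a *: avg l f.
Proof. by rewrite /avg tsumZ !scalerA mulrC. Qed.

Lemma tsum_avg n (sg : nat -> V) l f : tsum n sg (avg l f) = avg l (tsum n sg f).
Proof. by rewrite /avg tsumZ tsumC. Qed.

Lemma avgC l l' f : avg l (avg l' f) = avg l' (avg l f).
Proof. by rewrite {2 3}/avg avgZ tsum_avg. Qed.

Lemma nrm_avg l f : nrm (avg l f) <= nrm f.
Proof.
rewrite nrmZ ger0_norm ?invr_ge0 //.
case: l => [|l]; first by rewrite invr0 mul0r nrm_ge0.
by rewrite ler_pdivrMl ?ltr0n // nrm_tsum.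
Qed.

Lemma shift_avg_nat l e f :
  nrm (trans (one *+ e) (avg l f) - avg l f) <= 2 * e%:R / l%:R * nrm f.
Proof.
rewrite /avg transZ -scalerBr nrmZ ger0_norm ?invr_ge0 //.
have -> : 2 * e%:R / l%:R * nrm f = l%:R^-1 * (2 * e%:R * nrm f) by ring.
rewrite ler_wpM2l ?invr_ge0 //.
have -> : trans (one *+ e) (tsum l (fun y => one *+ y) f) =
    \sum_(u < l) trans (one *+ (u + e)) f.
  by rewrite /tsum trans_sum; apply: eq_bigr => u _; rewrite trans_trans addnC mulrnDr.
apply: (le_trans (@sum_shiftB R V (fun u => trans (one *+ u) f) l e (nrm f) _)) => [i|].
  by rewrite nrm_trans_op.
by [].
Qed.

Lemma shift_avg l (z z' : int) f :
  nrm (trans (one *~ z) (avg l f) - trans (one *~ z') (avg l f))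
    <= 2 * `|z - z'|%:~R / l%:R * nrm f.
Proof.
wlog zz' : z z' / z' <= z.
  move=> wl; have [zz'|z'z] := leP z' z; first exact: wl.
  by rewrite nrmBC distrC wl // ltW.
rewrite ger0_norm ?subr_ge0 //.
have [e ze] : exists e : nat, z = z' + e%:Z by exists `|z - z'|%N; lia.
have -> : z - z' = e%:Z by lia.
rewrite ze mulrzDr -trans_trans -transB nrm_trans_op.
exact: shift_avg_nat.
Qed.

Lemma avg_avg d l f : (0 < d)%N ->
  nrm (avg d (avg l f) - avg l f) <= 2 * d%:R / l%:R * nrm f.
Proof.
move=> d0; have d0' : d%:R != 0 :> R by rewrite pnatr_eq0 -lt0n.
have -> : avg d (avg l f) - avg l f =
   d%:R^-1 *: \sum_(y < d) (trans (one *+ y) (avg l f) - avg l f).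
  rewrite sumrB scalerBr sumr_const card_ord -[X in _ = _ - _ *: X]scaler_nat scalerA mulVf // scale1r.
  by [].
rewrite nrmZ ger0_norm ?invr_ge0 // ler_pdivrMl ?ltr0n //.
apply: nrm_sum_le => y; apply: (le_trans (shift_avg_nat _ _ _)).
rewrite ler_wpM2r ?nrm_ge0 // ler_wpM2r ?invr_ge0 // ler_wpM2l // ler_nat; exact: ltnW.
Qed.

(** Boxes of length [d] placed at step [d] tile a box of length [n * d]. *)
Lemma ap_avg n d f : (0 < d)%N -> (0 < n)%N ->
  tsum n (fun v => one *+ (v * d)) (avg d f) = n%:R *: avg (n * d) f.
Proof.
move=> d0 n0; rewrite /avg tsumZ scalerA natrM invfM mulrA divff ?pnatr_eq0 -?lt0n //.
rewrite mul1r; congr (_ *: _).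
elim: n {n0} => [|n IH]; first by rewrite /tsum mul0n !big_ord0.
rewrite [LHS]big_ord_recr /= [X in X + _]IH mulSn addnC /tsum big_split_ord /=.
congr (_ + _); rewrite trans_sum; apply: eq_bigr => v _.
by rewrite trans_trans mulrnDr.
Qed.

(** When [d] is small against [l], a smoothing of length [d] can be inserted at little cost;
    [ap_avg] then turns the progression into a box of length [n * d], and when [l] is small against
    [n * d] this box absorbs the smoothing of length [l]. *)
Lemma ap_smooth n d l f : (0 < d)%N -> (0 < l)%N ->
  nrm (tsum n (fun v => one *+ (v * d)) (avg l f) - n%:R *: avg (n * d) f)
   <= n%:R * (2 * d%:R / l%:R + 2 * l%:R / (n * d)%:R) * nrm f.
Proof.
move=> d0 l0; have [->|n0] := posnP n.
  by rewrite /tsum big_ord0 scale0r subr0 nrm0 !mul0r.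
apply: (le_trans (nrm_trans (tsum n (fun v => one *+ (v * d)) (avg d (avg l f))) _ _)).
rewrite mulrDr mulrDl; apply: lerD.
  rewrite nrmBC -tsumB; apply: (le_trans (nrm_tsum _ _ _)).
  by rewrite -mulrA ler_wpM2l // avg_avg.
rewrite ap_avg // -scalerBr nrmZ ger0_norm // -mulrA ler_wpM2l //.
by rewrite avgC avg_avg.
Qed.

(* Useful when the step [d] and the deviation [e] are well below the scale [l'], and
   the length [n * d] is well above [l] *)
Lemma block_bound n d l l' f (s : nat -> int) (s0 : int) e :
  (0 < d)%N -> (0 < l')%N -> (l' <= l)%N ->
  (forall v, (v < n)%N -> `|s v - (s0 + (v * d)%:Z)| <= e%:Z) ->
  nrm (tsum n (fun v => one *~ s v) (avg l' f - avg l f)) <=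
   n%:R * (4 * (d + e)%:R / l'%:R + 4 * l%:R / (n * d)%:R) * nrm f.
Proof.
move=> d0 l'0 l'l hs; have l0 : (0 < l)%N by exact: leq_trans l'0 l'l.
pose P k := tsum n (fun v => one *+ (v * d)) (avg k f).
have step k : (0 < k)%N ->
    nrm (tsum n (fun v => one *~ s v) (avg k f) - trans (one *~ s0) (P k))
     <= n%:R * (2 * e%:R / k%:R * nrm f).
  move=> k0; rewrite /P /tsum trans_sum -sumrB; apply: nrm_sum_le => v.
  rewrite trans_trans -[one *+ _]/(one *~ (v * d)%:Z) -mulrzDr.
  apply: (le_trans (shift_avg _ _ _ _)).
  rewrite ler_wpM2r ?nrm_ge0 // ler_wpM2r ?invr_ge0 // ler_wpM2l //.
  by have := hs v (ltn_ord v); rewrite -(ler_int R).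
(* Both scales lead to the same box [avg (n * d) f], which cancels in the difference. *)
have PP : nrm (P l' - P l) <= n%:R * (2 * d%:R / l'%:R + 2 * l'%:R / (n * d)%:R) * nrm f
     + n%:R * (2 * d%:R / l%:R + 2 * l%:R / (n * d)%:R) * nrm f.
  apply: (le_trans (nrm_trans (n%:R *: avg (n * d) f) _ _)).
  by apply: lerD; last rewrite nrmBC; exact: ap_smooth.
have l'R : 0 < l'%:R :> R by rewrite ltr0n.
have ll : l'%:R <= l%:R :> R by rewrite ler_nat.
have h1 x : 0 <= x -> 2 * x / l%:R <= 2 * x / l'%:R :> R.
  by move=> x0; rewrite ler_wpM2l ?mulr_ge0 // lef_pV2 ?posrE // (lt_le_trans l'R).
have h2 : 2 * l'%:R / (n * d)%:R <= 2 * l%:R / (n * d)%:R :> R.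
  by rewrite ler_wpM2r ?invr_ge0 // ler_wpM2l.
have h : nrm (tsum n (fun v => one *~ s v) (avg l' f - avg l f)) <=
  n%:R * (2 * e%:R / l'%:R * nrm f) + (nrm (P l' - P l) + n%:R * (2 * e%:R / l%:R * nrm f)).
  rewrite tsumB; apply: (le_trans (nrm_trans (trans (one *~ s0) (P l')) _ _)).
  rewrite lerD ?step //; apply: (le_trans (nrm_trans (trans (one *~ s0) (P l)) _ _)).
  by rewrite lerD //; [rewrite -transB nrm_trans_op | rewrite nrmBC step].
apply: (le_trans h).
have -> : n%:R * (4 * (d + e)%:R / l'%:R + 4 * l%:R / (n * d)%:R) * nrm f =
   n%:R * nrm f * (2 * (2 * d%:R / l'%:R) + 2 * (2 * e%:R / l'%:R) + 2 * (2 * l%:R / (n * d)%:R)).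
  by rewrite natrD; ring.
have nf : 0 <= n%:R * nrm f by rewrite mulr_ge0 ?nrm_ge0.
have k1 := ler_wpM2l nf (h1 _ (ler0n R e)).
have k2 := ler_wpM2l nf (h1 _ (ler0n R d)).
have k3 := ler_wpM2l nf h2.
lra.
Qed.

End Weyl.

(** * Mixed differences of the logarithm *)

Section MeanValue.
Context {R : realType}.
Implicit Types (f : R -> R) (F : nat -> R -> R).

Fixpoint mdiffR f (hs : seq (nat * nat)) : R -> R :=
  if hs is (h, h') :: hs' then mdiffR (fun x => f (x + h%:R) - f (x + h'%:R)) hs'
  else f.

Lemma mdiff_natR f hs u : mdiff (fun u => f u%:R) hs u = mdiffR f hs u%:R.
Proof.
elim: hs f => [//|[h h'] hs IH] f /=; rewrite -IH.
by congr (mdiff _ hs u); apply/funext => v; rewrite !natrD.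
Qed.

Definition derive_chain F := forall i (x : R), 0 <= x -> is_derive x (1 : R) (F i) (F i.+1 x).

Lemma mvt_nonneg f f' (x y : R) : 0 <= x -> 0 <= y ->
  (forall z : R, 0 <= z -> is_derive z (1 : R) f (f' z)) ->
  exists z, [/\ Num.min x y <= z, z <= Num.max x y & f x - f y = (x - y) * f' z].
Proof.
wlog xy : x y / y <= x.
  move=> wl x0 y0 df; case/orP: (le_total y x) => [yx|xy]; first exact: wl yx x0 y0 df.
  have [z [h1 h2 h3]] := wl y x xy y0 x0 df.
  by exists z; split; rewrite 1?minC 1?maxC //; lra.
move=> x0 y0 df.
have [||z zI fz] := @MVT_segment R f f' y x xy.
- by move=> z /andP[yz _]; apply: df; apply: le_trans y0 _; move: yz; rewrite bnd_simp => /ltW.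
- apply: derivable_within_continuous => z; rewrite in_itv /= => /andP[yz _].
  by have [] := df z (le_trans y0 yz).
move: zI; rewrite in_itv /= => /andP[yz zx]; exists z; split.
- by rewrite ge_min yz orbT.
- by rewrite le_max zx.
by rewrite fz mulrC.
Qed.

Lemma is_derive_shift f (df x h : R) :
  is_derive (x + h) (1 : R) f df -> is_derive x (1 : R) (fun y => f (y + h)) df.
Proof.
move=> d.
have e : is_derive x (1 : R) (fun y : R => y + h) 1.
  have := is_deriveD (is_derive_id x (1 : R)) (is_derive_cst h x (1 : R)).
  by rewrite addr0.
have := @is_derive1_comp R f (fun y => y + h) x df 1 d e.
by rewrite mulr1.
Qed.

Lemma chain_diff F (h h' : nat) : derive_chain F ->
  derive_chain (fun i x => F i (x + h%:R) - F i (x + h'%:R)).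
Proof.
move=> dF i x x0; apply: is_deriveB; apply: is_derive_shift; apply: dF;
  exact: addr_ge0.
Qed.

Definition hprod (hs : seq (nat * nat)) : R := \prod_(p <- hs) (p.1%:R - p.2%:R).

(** One use of the mean value theorem per pair. Differencing acts on all derivatives at once, so the
    induction runs over a whole chain of derivatives rather than over one function. *)
Lemma mdiffR_mvt F hs H x : derive_chain F -> 0 <= x ->
  all (fun p => (p.1 <= H) && (p.2 <= H))%N hs ->
  exists z, [/\ x <= z, z <= x + (size hs * H)%:R & mdiffR (F 0%N) hs x = hprod hs * F (size hs) z].
Proof.
elim: hs F x => [|[h h'] hs IH] F x dF x0 /=.
  by move=> _; exists x; rewrite mul0n addr0 /hprod big_nil mul1r.
move=> /andP[/andP[hH h'H] hsH].
have [z [xz zx Ez]] := IH (fun i x => F i (x + h%:R) - F i (x + h'%:R)) x (chain_diff F h h' dF) x0 hsH.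
have z0 : 0 <= z := le_trans x0 xz.
have [y [y1 y2 Ey]] := @mvt_nonneg (F (size hs)) (F (size hs).+1) (z + h%:R) (z + h'%:R)
  (addr_ge0 z0 (ler0n _ _)) (addr_ge0 z0 (ler0n _ _)) (fun z hz => dF _ z hz).
have hR : h%:R <= H%:R :> R by rewrite ler_nat.
have h'R : h'%:R <= H%:R :> R by rewrite ler_nat.
have := ler0n R h; have := ler0n R h' => ? ?.
exists y; split.
- by apply: le_trans xz _; apply: le_trans y1; rewrite le_min !lerDl !ler0n.
- apply: (le_trans y2); rewrite mulSn natrD ge_max; apply/andP; split; lra.
- by rewrite Ez Ey /hprod big_cons /=; ring.
Qed.

(** The successive derivatives of [c * ln (L + x)]. *)
Definition log_chain (c L : R) i (x : R) : R :=
  if i is n.+1 then c * ((-1) ^+ n * n`!%:R * (L + x)^-1 ^+ n.+1) else c * ln (L + x).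

Lemma log_chainP c L : 0 < L -> derive_chain (log_chain c L).
Proof.
move=> L0 i x x0; have Lx : 0 < L + x by exact: ltr_wpDr.
have d1 : is_derive x (1 : R) (fun y : R => L + y) 1.
  have := is_deriveD (is_derive_cst L x (1 : R)) (is_derive_id x (1 : R)).
  by rewrite add0r.
case: i => [|n].
  have d2 := @is_derive1_comp R (@ln R) (fun y => L + y) x _ _ (is_derive1_ln Lx) d1.
  have d3 := is_deriveZ c d2.
  apply: (is_derive_eq d3).
  by rewrite /log_chain expr0 mul1r expr1 mul1r mulr1.
have d2 := @is_deriveV R _ x 1 _ (lt0r_neq0 Lx) d1.
have d3 := is_deriveX n.+1 d2.
have d4 := is_deriveZ (c * ((-1) ^+ n * n`!%:R)) d3.
have -> : log_chain c L n.+1 = (c * ((-1) ^+ n * n`!%:R)) \*: ((fun y => (L + y)^-1) ^+ n.+1).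
  by apply/funext => y; rewrite /log_chain mulrA exprfctE.
apply: (is_derive_eq d4).
rewrite -exprVn /log_chain /GRing.scale /= factS natrM; set y := (L + x)^-1.
rewrite !exprS; ring.
Qed.

(** The slope is the derivative of the mixed difference at [u0]: by [mdiffR_mvt] it is [hprod hs]
    times the derivative of order [k.+1] of the logarithm at a nearby point, whose sign is split off
    so that [D] is positive when [c] is. The error is the second-order Taylor term. *)
Lemma log_mdiff (c : R) (L H n u0 : nat) hs : (0 < L)%N -> 0 <= c ->
  all (fun p => (p.1 <= H) && (p.2 <= H))%N hs ->
  let k := size hs in
  exists D : R, [/\ 
    forall v, (v <= n)%N ->
    `|mdiff (fun u => c * ln (L%:R + u%:R)) hs (u0 + v)%N
      - mdiff (fun u => c * ln (L%:R + u%:R)) hs u0 - v%:R * ((-1) ^+ k * hprod hs * D)|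
     <= c * `|hprod hs| * k.+1`!%:R / L%:R ^+ k.+2 * n%:R ^+ 2,
    c * k`!%:R / (L + u0 + k * H)%:R ^+ k.+1 <= D & D <= c * k`!%:R / L%:R ^+ k.+1].
Proof.
move=> L0 c0 hsH k.
have LR : 0 < L%:R :> R by rewrite ltr0n.
have ch := log_chainP c L%:R LR.
pose F := log_chain c L%:R.
have ch1 : derive_chain (fun i => F i.+1) by move=> i x x0; exact: ch.
have ch2 : derive_chain (fun i => F i.+2) by move=> i x x0; exact: ch.
have [z [z1 z2 Ez]] := mdiffR_mvt _ _ _ _ ch1 (ler0n _ u0) hsH.
have Lz : 0 < L%:R + z by rewrite ltr_wpDr // (le_trans _ z1).
exists (c * k`!%:R * (L%:R + z)^-1 ^+ k.+1); split; last first.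
- rewrite -exprVn ler_wpM2l ?mulr_ge0 // lerXn2r ?nnegrE ?invr_ge0 ?(ltW Lz) ?(ltW LR) //.
  by rewrite lef_pV2 ?posrE // lerDl (le_trans _ z1).
- rewrite -exprVn ler_wpM2l ?mulr_ge0 // lerXn2r ?nnegrE ?invr_ge0 ?(ltW Lz) ?ler0n //.
  rewrite lef_pV2 ?posrE //; last by rewrite ltr0n; lia.
  by rewrite -addnA natrD lerD2l natrD.
move=> v vn.
have dR i : forall x : R, 0 <= x -> is_derive x (1 : R) (mdiffR (F i) hs) (mdiffR (F i.+1) hs x).
  move=> x x0.
  have : derive_chain F by exact: ch.
  move: (F) => G; elim: hs {hsH k z1 z2 Ez} G => [|[h h'] hs IH] G dG /=; first exact: dG.
  exact: (IH (fun i x => G i (x + h%:R) - G i (x + h'%:R)) (chain_diff G h h' dG)).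
have E0 u : mdiff (fun u => c * ln (L%:R + u%:R)) hs u = mdiffR (F 0%N) hs u%:R.
  by rewrite -mdiff_natR.
rewrite !E0.
have [y [y1 y2 Ey]] := @mvt_nonneg _ _ (u0 + v)%:R u0%:R (ler0n _ _) (ler0n _ _) (dR 0%N).
have uv : u0%:R <= (u0 + v)%:R :> R by rewrite ler_nat leq_addr.
rewrite (min_idPr uv) in y1; rewrite (max_idPl uv) in y2.
have y0 : 0 <= y := le_trans (ler0n _ _) y1.
have [w [w1 w2 Ew]] := @mvt_nonneg _ _ y u0%:R y0 (ler0n _ _) (dR 1%N).
rewrite (min_idPr y1) in w1.
have [t [t1 t2 Et]] := mdiffR_mvt _ _ _ _ ch2 (le_trans (ler0n _ u0) w1) hsH.
rewrite Et in Ew.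
have -> : mdiffR (F 0%N) hs (u0 + v)%:R - mdiffR (F 0%N) hs u0%:R
   - v%:R * ((-1) ^+ k * hprod hs * (c * k`!%:R * (L%:R + z)^-1 ^+ k.+1)) =
   v%:R * ((y - u0%:R) * (hprod hs * F (size hs).+2 t)).
  rewrite -Ew Ey Ez natrD /F /log_chain -/k; ring.
have Lt : 0 < L%:R + t by rewrite ltr_wpDr // (le_trans _ t1) // (le_trans _ w1).
have Ft : `|F (size hs).+2 t| <= c * k.+1`!%:R / L%:R ^+ k.+2.
  rewrite /F /log_chain -/k 3!normrM normrX normrN1 expr1n mul1r normr_nat (ger0_norm c0).
  rewrite mulrA ler_wpM2l ?mulr_ge0 // normrX ger0_norm ?invr_ge0 ?(ltW Lt) // -exprVn.
  rewrite lerXn2r ?nnegrE ?invr_ge0 ?(ltW Lt) ?(ltW LR) //.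
  by rewrite lef_pV2 ?posrE // lerDl (le_trans _ t1) // (le_trans _ w1).
have vR : v%:R <= n%:R :> R by rewrite ler_nat.
have yv : `|y - u0%:R| <= n%:R.
  by rewrite ger0_norm ?subr_ge0 //; rewrite natrD in y2; lra.
rewrite (normrM v%:R) normr_nat (normrM (y - _)) (normrM (hprod hs)).
have -> : c * `|hprod hs| * k.+1`!%:R / L%:R ^+ k.+2 * n%:R ^+ 2 =
   n%:R * (n%:R * (`|hprod hs| * (c * k.+1`!%:R / L%:R ^+ k.+2))) by ring.
apply: ler_pM vR _; rewrite ?ler0n ?mulr_ge0 ?normr_ge0 //.
apply: ler_pM yv _; rewrite ?mulr_ge0 ?normr_ge0 //.
by rewrite ler_wpM2l.
Qed.

End MeanValue.

(** * Averages over logarithms of integers *)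

Section Band.
Context {R : realType} {V : finZmodType}.
Variable one : V.
Implicit Types (f : V -> R).

(** On a block short enough for the curvature error [X] to be small, the differenced phase is a
    progression up to bounded deviation, so [block_bound] applies. *)
Lemma phase_block (lam : nat -> int) (c : R) (L H u0 n l l' : nat) hs f (Dlo Dup X : R) :
  (0 < L)%N -> 0 <= c -> (0 < l')%N -> (l' <= l)%N -> (0 < n)%N ->
  (forall u, `|(lam u)%:~R - c * ln (L%:R + u%:R)| <= 1) ->
  all (fun p => (p.1 <= H) && (p.2 <= H))%N hs ->
  let k := size hs in let P := `|hprod (R := R) hs| in
  1 <= Dlo -> Dlo <= P * (c * k`!%:R / (L + u0 + k * H)%:R ^+ k.+1) ->
  P * (c * k`!%:R / L%:R ^+ k.+1) <= Dup ->
  c * P * k.+1`!%:R / L%:R ^+ k.+2 * n%:R ^+ 2 <= X ->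
  nrm (tsum n (fun v => one *~ mdiff lam hs (u0 + v)%N) (avg one l' f - avg one l f)) <=
   n%:R * (4 * (Dup + 2 ^+ k.+1 + n%:R + X + 1) / l'%:R + 8 * l%:R / (n%:R * Dlo)) * nrm f.
Proof.
move=> L0 c0 l'0 l'l n0 lamE hsH k P Dlo1 hlo hup hX.
have [D [D1 D2 D3]] := @log_mdiff R c L H n u0 hs L0 c0 hsH.
rewrite -/k in D1 D2 D3.
pose q : R := (-1) ^+ k * hprod hs.
have qP : `|q| = P by rewrite normrM normrX normrN1 expr1n mul1r.
have D0 : 0 <= D by apply: le_trans D2; rewrite !mulr_ge0 ?invr_ge0 ?exprn_ge0.
have P0 : 0 <= P by exact: normr_ge0.
have DPlo : Dlo <= P * D by apply: le_trans hlo _; rewrite ler_wpM2l.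
have DPup : P * D <= Dup by apply: le_trans hup; rewrite ler_wpM2l.
have PD1 : 1 <= P * D by exact: le_trans DPlo.
pose d := Num.truncn (P * D).
have /andP[d1 d2] : d%:R <= P * D < d.+1%:R by apply: truncn_itv; lra.
have d0 : (0 < d)%N by rewrite truncn_gt0.
have X0 : 0 <= X.
  by apply: le_trans hX; rewrite !mulr_ge0 ?invr_ge0 ?exprn_ge0.
(* The deviation adds the rounding [2^k] at each of the two indices compared, less than 1 per term
   for truncating the step to the integer [d], and the curvature. *)
pose e := (2 ^ k.+1 + n + Num.truncn X + 1)%N.
have eX : e%:R <= 2 ^+ k.+1 + n%:R + X + 1.
  rewrite !natrD natrX; have := truncn_itv X0; lra.
pose t v := mdiff lam hs (u0 + v).
pose Phi u := mdiff (fun u => c * ln (L%:R + u%:R)) hs u.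
have tE v : `|(t v)%:~R - Phi (u0 + v)%N| <= 2 ^+ k.
  rewrite /t -(mdiff_morph (intr : {additive int -> R})).
  exact: mdiff_dist.
have t0E : `|(t 0%N)%:~R - Phi u0| <= 2 ^+ k by have := tE 0%N; rewrite addn0.
have lin v : (v <= n)%N -> `|Phi (u0 + v)%N - Phi u0 - v%:R * (q * D)| <= X.
  by move=> /D1 h; apply: (le_trans h).
have step (s : int) (sR : R) : (s%:~R = sR) -> `|sR| = 1 -> sR * q = P -> forall v, (v < n)%N ->
   `|s * t v - (s * t 0%N + (v * d)%:Z)| <= e%:Z.
  move=> ss sR1 sq v vn; rewrite -(ler_int R) intr_norm.
  have h1 : `|sR * ((t v)%:~R - Phi (u0 + v)%N)| <= 2 ^+ k by rewrite normrM sR1 mul1r.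
  have h2 : `|sR * ((t 0%N)%:~R - Phi u0)| <= 2 ^+ k by rewrite normrM sR1 mul1r.
  have h3 : `|sR * (Phi (u0 + v)%N - Phi u0 - v%:R * (q * D))| <= X.
    by rewrite normrM sR1 mul1r lin // ltnW.
  have vn' : v%:R <= n%:R :> R by rewrite ler_nat ltnW.
  have v0 : 0 <= v%:R :> R by [].
  have h4 : 0 <= v%:R * (P * D - d%:R) <= n%:R.
    rewrite mulr_ge0 ?subr_ge0 //=; apply: le_trans vn'.
    by rewrite ler_piMr //; move: d2; rewrite -natr1; lra.
  have h5 : 2 ^+ k + 2 ^+ k + n%:R + X <= e%:R.
    rewrite !natrD natrX exprS; have := truncn_itv X0; rewrite -natr1; lra.
  have -> : (s * t v - (s * t 0%N + (v * d)%:Z))%:~R =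
    sR * ((t v)%:~R - Phi (u0 + v)%N) - sR * ((t 0%N)%:~R - Phi u0)
    + sR * (Phi (u0 + v)%N - Phi u0 - v%:R * (q * D)) + v%:R * (P * D - d%:R).
    rewrite -sq rmorphB rmorphD !rmorphM /= ss; ring.
  move: h1 h2 h3 h4; rewrite !ler_norml => /andP[? ?] /andP[? ?] /andP[? ?] /andP[? ?].
  by apply/andP; split; rewrite -?pmulrn; lra.
have main (s : nat -> int) s0 : (forall v, (v < n)%N -> `|s v - (s0 + (v * d)%:Z)| <= e%:Z) ->
  nrm (tsum n (fun v => one *~ s v) (avg one l' f - avg one l f)) <=
   n%:R * (4 * (Dup + 2 ^+ k.+1 + n%:R + X + 1) / l'%:R + 8 * l%:R / (n%:R * Dlo)) * nrm f.
  move=> hs'; apply: (le_trans (block_bound _ _ _ _ _ _ _ _ _ d0 l'0 l'l hs')).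
  rewrite ler_wpM2r ?nrm_ge0 // ler_wpM2l // lerD //.
    rewrite ler_wpM2r ?invr_ge0 // ler_wpM2l // natrD; lra.
  have nR : 0 < n%:R :> R by rewrite ltr0n.
  have dlo : Dlo <= 2 * d%:R.
    have : 1 <= d%:R :> R by rewrite ler1n.
    move: d2; rewrite -natr1; lra.
  have -> : 8 * l%:R / (n%:R * Dlo) = 4 * l%:R * (2 / (n%:R * Dlo)) by ring.
  rewrite ler_wpM2l ?mulr_ge0 // natrM -[leRHS]invrK invf_div lef_pV2 ?posrE.
  - by rewrite ler_pdivrMr // -mulrA ler_wpM2l // mulrC.
  - by rewrite mulr_gt0 // ltr0n.
  - by rewrite divr_gt0 // mulr_gt0 //; lra.
have [q0|q0] := leP 0 q.
  apply: (main t (t 0%N)) => v vn.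
  have hq : 1 * q = P by rewrite mul1r -qP ger0_norm.
  by have := step 1 1 erefl (normr1 _) hq v vn; rewrite !mul1r.
have -> : nrm (tsum n (fun v => one *~ mdiff lam hs (u0 + v)%N) (avg one l' f - avg one l f))
  = nrm (tsum n (fun v => one *~ (- t v)) (avg one l' f - avg one l f)).
  have -> : (fun v => one *~ - t v) = (fun v => - (one *~ t v)).
    by apply/funext => v; rewrite mulrNz.
  by rewrite nrm_tsumN.
apply: (main (fun v => - t v) (- t 0%N)) => v vn.
have hq : -1 * q = P by rewrite mulN1r -qP ltr0_norm.
have h1 : (-1)%:~R = -1 :> R by [].
have h2 : `|-1 : R| = 1 by rewrite normrN1.
by have := step (-1) (-1) h1 h2 hq v vn; rewrite !mulN1r.
Qed.

Lemma tsum_blocks w n (s : nat -> V) f :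
  tsum (w * n) s f = \sum_(i < w) tsum n (fun v => s (i * n + v)%N) f.
Proof.
elim: w => [|w IH]; first by rewrite /tsum mul0n !big_ord0.
rewrite [RHS]big_ord_recr /= -IH mulSn addnC /tsum big_split_ord /=.
by congr (_ + _); apply: eq_bigr => v _.
Qed.

Lemma hprod_bounds hs H H0 : all (spread H H0) hs ->
  H0%:R ^+ size hs <= `|hprod (R := R) hs| <= H%:R ^+ size hs.
Proof.
elim: hs => [_|[h h'] hs IH /=]; first by rewrite /hprod big_nil normr1 expr0 lexx.
move=> /andP[/and3P[/= hH h'H hh] /IH /andP[lo up]].
rewrite /hprod big_cons normrM !exprS -/(hprod hs).
have hR : h%:R <= H%:R :> R by rewrite ler_nat ltnW.
have h'R : h'%:R <= H%:R :> R by rewrite ler_nat ltnW.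
have := ler0n R h; have := ler0n R h' => ? ?.
rewrite /= !ler_pM ?exprn_ge0 //; first by rewrite ler_norml; apply/andP; split; lra.
case/orP: hh; rewrite -(ler_nat R) natrD => ?.
  by rewrite distrC ler_normr; apply/orP; left; lra.
by rewrite ler_normr; apply/orP; left; lra.
Qed.

End Band.

(** * The saving on the band between two consecutive scales *)

Section BandEstimate.
Context {R : realType} {V : finZmodType}.
Variable one : V.
Implicit Types (f : V -> R).

Lemma ln2_ge_half : 2^-1 <= ln (2 : R).
Proof.
have := @le_ln1Dx R (- 2^-1); rewrite (_ : 1 + - 2^-1 = 2^-1); last lra.
by rewrite lnV ?posrE // => h; have := h _; lra.
Qed.

Lemma ln2_le1 : ln (2 : R) <= 1.
Proof. by have := @le_ln1Dx R 1; rewrite -[1 + 1]/(2); apply; lra. Qed.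

Lemma pow_ratio (be : R) (a c : nat) : 1 <= be -> (a < c)%N -> be ^+ a / be ^+ c <= be^-1.
Proof.
move=> b1 ac; have b0 : 0 < be by lra.
rewrite ler_pdivrMr ?exprn_gt0 // -(ler_pM2l b0) mulrA divff ?lt0r_neq0 // mul1r.
by rewrite -exprS ler_weXn2l.
Qed.

Lemma fact_mono a c : (a <= c)%N -> (a`! <= c`!)%N.
Proof.
elim: c => [|c IH]; first by rewrite leqn0 => /eqP ->.
rewrite leq_eqVlt => /predU1P[->//|]; rewrite ltnS => /IH h.
by rewrite factS (leq_trans h) // leq_pmull.
Qed.

(** Sums the errors of [phase_block], each of which turns out to be a constant over [b]: step,
    curvature, roundings and block length in the first term, length of the progression in the
    second. *)
Definition band_const K := (4 * (4 * K.+1`! + 2 ^ K.+1 + 2) + 8 * 4 ^ K.+1)%N.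

Variables (p K jm b : nat).
(** The differencing shifts range up to [b^g]. Relative to the finer scale, the curvature error
    below has order [b^(2 k - 2 K - 1 - q)], and the value [2 K + 5] is what makes this at most
    [1 / b] for all [k <= K]. *)
Let g := (2 * K + 5)%N.
Let r := (p + g)%N.
Let Jx := (jm + r + 1)%N.

(** The scale dictates the number [k] of differencings. With shifts of size [b^g] the step is about
    [b^(Jx - p k - p - g)], and the finer scale is [b^(Jx - p k - g - q)] with [q < p]: the step is
    smaller than the scale, by at most a factor [b^p] up to constants and the spread of the
    shifts. *)
Lemma band_estimate (lam : nat -> int) (c th : R) j f :
  (0 < p)%N -> (4 ^ K.+2 <= b)%N -> (K <= b)%N ->
  (g.-1 <= j < jm)%N -> ((j - g.-1) %/ p <= K)%N ->
  (b ^ Jx)%:R <= c <= 2 * (b ^ Jx)%:R ->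
  (forall u, `|(lam u)%:~R - c * ln ((b ^ r)%:R + u%:R)| <= 1) ->
  0 <= th <= 1 -> (band_const K)%:R / b%:R <= th ^+ (2 ^ K) ->
  nrm (tsum (b ^ r) (fun u => one *~ lam u)
         (avg one (b ^ (Jx - j.+1)) f - avg one (b ^ (Jx - j)) f))
    <= 18 * (b ^ r)%:R * th * nrm f.
Proof.
move=> p0 b4 Kb /andP[gj jjm] kK /andP[cJ cJ2] lamE th01 hth.
set k := ((j - g.-1) %/ p)%N in kK.
pose q := ((j - g.-1) %% p)%N.
have jE : j = (p * k + (2 * K + 4) + q)%N.
  have := divn_eq (j - g.-1) p; rewrite -/k -/q.
  rewrite (_ : g.-1 = 2 * K + 4)%N in gj *; last by rewrite /g; lia.
  by rewrite (mulnC k); lia.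
have qp : (q < p)%N by rewrite ltn_mod.
(* Blocks have length [b^w]. The value makes the progression longer than the coarser scale by
   exactly one factor [b], up to constants, even when every difference of shifts is only [b^(g.-1)];
   this costs the summand [k]. *)
pose w := (p - q + 2 + k)%N.
have wr : (w <= r)%N by rewrite /w /r /g; lia.
have CK2n : (2 <= band_const K)%N by rewrite /band_const; clear; lia.
have g1 : (g.-1 = 2 * K + 4)%N by rewrite /g addnS.
(* In exponents of [b]: [E1] makes the step at least 1, [E2] puts it below the finer scale, [E3]
   does so for the curvature and [E4] for the block length, and [E5] makes the progression run past
   the coarser scale. *)
have E1 : ((r * k.+1).+1 <= g.-1 * k + Jx)%N by rewrite g1 /Jx /r /g; lia.
have E2 : ((2 * K + 5) * k + Jx < r * k.+1 + (Jx - j.+1))%N by rewrite /Jx /r /g; lia.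
have E3 : (Jx + (2 * K + 5) * k + w * 2 < r * k.+2 + (Jx - j.+1))%N by rewrite /Jx /r /g /w; lia.
have E4 : (w < Jx - j.+1)%N by rewrite /Jx /r /g /w; lia.
have E5 : (r * k.+1 + (Jx - j) < w + (g.-1 * k + Jx))%N by rewrite g1 /Jx /r /g /w; lia.
pose be : R := b%:R.
have b1 : (1 <= b)%N by apply: leq_trans b4; rewrite expn_gt0.
have be1 : 1 <= be by rewrite ler1n.
have be0 : 0 < be by lra.
have beX e : 0 < be ^+ e by rewrite exprn_gt0.
pose Df := avg one (b ^ (Jx - j.+1)) f - avg one (b ^ (Jx - j)) f.
have DfB : nrm Df <= 2 * nrm f.
  by apply: (le_trans (nrmB _ _)); have := nrm_avg one (b ^ (Jx - j.+1)) f;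
     have := nrm_avg one (b ^ (Jx - j)) f; lra.
have CK2 : 2 <= (band_const K)%:R :> R by rewrite ler_nat.
have key hs : size hs = k -> all (spread (b ^ g) (b ^ g.-1)) hs ->
   nrm (tsum (b ^ r) (mdiff (fun u => one *~ lam u) hs) Df) <=
     (b ^ r)%:R * th ^+ (2 ^ K) * (2 * nrm f).
  move=> hsk hsg.
  have -> : mdiff (fun u => one *~ lam u) hs = (fun u => one *~ mdiff lam hs u).
    by apply/funext => u; rewrite -(mdiff_morph (intmul one : {additive int -> V})).
  (* The differenced phase is close to linear on blocks of length [b^w] only, so the range of [u] is
     cut into such blocks. *)
  have -> : (b ^ r = b ^ (r - w) * b ^ w)%N by rewrite -expnD subnK.
  rewrite tsum_blocks natrM -!mulrA; apply: nrm_sum_le => i; rewrite mulrA.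
  have /andP[Plo Pup] := @hprod_bounds R _ _ _ hsg.
  rewrite hsk !natrX -!exprM -/be in Plo Pup.
  have hsH : all (fun p => (p.1 <= b ^ g) && (p.2 <= b ^ g))%N hs.
    by apply: sub_all hsg => x /and3P[h1 h2 _]; rewrite (ltnW h1) (ltnW h2).
  have kf : (k`! <= K`!)%N by exact: fact_mono.
  have k1f : (k.+1`! <= K.+1`!)%N by exact: fact_mono.
  have LE : (b ^ r)%:R = be ^+ r by rewrite natrX.
  have [Jlo Jup] : be ^+ Jx <= c /\ c <= 2 * be ^+ Jx by rewrite -natrX.
  have c0 : 0 <= c by apply: le_trans Jlo; rewrite ltW.
  pose Dlo : R := be ^+ (g.-1 * k) * (be ^+ Jx / (4 ^+ K.+1 * be ^+ (r * k.+1))).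
  pose Dup : R := be ^+ (g * k) * (2 * be ^+ Jx * K`!%:R / be ^+ (r * k.+1)).
  pose X : R := 2 * be ^+ Jx * be ^+ (g * k) * K.+1`!%:R / be ^+ (r * k.+2) * be ^+ (w * 2).
  have b4R : 4 ^+ K.+1 <= be.
    rewrite -natrX ler_nat; apply: leq_trans b4; exact: leq_pexp2l (leqnSn _).
  have Dlo1 : 1 <= Dlo.
    rewrite /Dlo mulrA ler_pdivlMr ?mulr_gt0 ?exprn_gt0 // mul1r.
    apply: (@le_trans _ _ (be * be ^+ (r * k.+1))); first by rewrite ler_wpM2r // ltW.
    by rewrite -exprS -exprD ler_weXn2l.
  have hlo : Dlo <= `|hprod (R := R) hs| * (c * (size hs)`!%:R / (b ^ r + i * b ^ w + size hs * b ^ g)%:R ^+ (size hs).+1).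
    rewrite hsk /Dlo; apply: ler_pM => //; rewrite ?divr_ge0 ?mulr_ge0 ?exprn_ge0 ?(ltW be0) //.
    apply: ler_pM => //; rewrite ?invr_ge0 ?mulr_ge0 ?exprn_ge0 ?(ltW be0) //.
      apply: (le_trans Jlo); rewrite ler_peMr // ler1n; exact: fact_gt0.
    have m0 : (0 < b ^ r + i * b ^ w + k * b ^ g)%N by rewrite !addn_gt0 expn_gt0 b1.
    rewrite lef_pV2 ?posrE ?mulr_gt0 ?exprn_gt0 ?ltr0n //.
    apply: (@le_trans _ _ ((4 * b ^ r)%:R ^+ k.+1)).
      rewrite lerXn2r ?nnegrE // ler_nat.
      have h1 : (i * b ^ w <= b ^ r)%N.
        rewrite -{2}(subnK wr) expnD leq_mul2r; apply/orP; right; exact: ltnW.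
      have h2 : (k * b ^ g <= b ^ r)%N.
        apply: (@leq_trans (b * b ^ g)); first by rewrite leq_mul2r (leq_trans kK Kb) orbT.
        by rewrite -expnS leq_pexp2l // /r -add1n leq_add2r.
      by move: h1 h2; clear; lia.
    rewrite natrM exprMn natrX -exprM ler_wpM2r ?exprn_ge0 ?(ltW be0) //.
    by rewrite ler_weXn2l // ler1n.
  have hup : `|hprod (R := R) hs| * (c * (size hs)`!%:R / (b ^ r)%:R ^+ (size hs).+1) <= Dup.
    rewrite hsk /Dup LE -exprM; apply: ler_pM => //; rewrite ?divr_ge0 ?mulr_ge0 ?exprn_ge0 ?(ltW be0) //.
    rewrite ler_wpM2r ?invr_ge0 ?exprn_ge0 ?(ltW be0) //; apply: ler_pM => //.
    by rewrite ler_nat.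
  have hX : c * `|hprod (R := R) hs| * (size hs).+1`!%:R / (b ^ r)%:R ^+ (size hs).+2 * (b ^ w)%:R ^+ 2 <= X.
    rewrite hsk /X LE natrX -!exprM ler_wpM2r ?exprn_ge0 ?(ltW be0) //.
    rewrite ler_wpM2r ?invr_ge0 ?exprn_ge0 ?(ltW be0) //; apply: ler_pM => //.
    - by rewrite mulr_ge0.
    - by apply: ler_pM => //.
    - by rewrite ler_nat.
  have l'l : (b ^ (Jx - j.+1) <= b ^ (Jx - j))%N by apply: leq_pexp2l => //; apply: leq_sub2l.
  have := @phase_block R V one lam c (b ^ r) (b ^ g) (i * b ^ w) (b ^ w)
     (b ^ (Jx - j)) (b ^ (Jx - j.+1)) hs f Dlo Dup X.
  rewrite !expn_gt0 b1 /= => /(_ isT c0 isT l'l isT lamE hsH Dlo1 hlo hup hX) h.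
  apply: (le_trans h); rewrite -mulrA -[leRHS]mulrA ler_wpM2l // mulrA ler_wpM2r ?nrm_ge0 //.
  rewrite hsk.
  apply: (@le_trans _ _ ((band_const K)%:R / be)); last first.
    by apply: (le_trans hth); rewrite ler_peMr ?exprn_ge0 ?ler1n //; case/andP: th01.
  have i0 : 0 <= be^-1 by rewrite invr_ge0 ltW.
  have nz e : be ^+ e != 0 by rewrite lt0r_neq0.
  have t1 : Dup / (b ^ (Jx - j.+1))%:R <= 2 * K`!%:R * be^-1.
    have -> : Dup / (b ^ (Jx - j.+1))%:R =
        2 * K`!%:R * (be ^+ (g * k + Jx) / be ^+ (r * k.+1 + (Jx - j.+1))).
      by rewrite /Dup natrX -/be !exprD; field; rewrite !nz.
    by rewrite ler_wpM2l ?mulr_ge0 // pow_ratio.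
  have t2 : X / (b ^ (Jx - j.+1))%:R <= 2 * K.+1`!%:R * be^-1.
    have -> : X / (b ^ (Jx - j.+1))%:R =
        2 * K.+1`!%:R * (be ^+ (Jx + g * k + w * 2) / be ^+ (r * k.+2 + (Jx - j.+1))).
      by rewrite /X natrX -/be !exprD; field; rewrite !nz.
    by rewrite ler_wpM2l ?mulr_ge0 // pow_ratio.
  have t3 : (b ^ w)%:R / (b ^ (Jx - j.+1))%:R <= be^-1 by rewrite !natrX pow_ratio.
  have t4 : 1 / (b ^ (Jx - j.+1))%:R <= be^-1.
    by rewrite natrX -(expr0 be) pow_ratio // (leq_ltn_trans _ E4).
  have t5 : 2 ^+ k.+1 / (b ^ (Jx - j.+1))%:R <= 2 ^+ K.+1 * be^-1.
    rewrite -[X in X / _]mulr1 -mulrA ler_pM ?exprn_ge0 ?divr_ge0 //.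
    by rewrite ler_weXn2l // ler1n.
  have t6 : (b ^ (Jx - j))%:R / ((b ^ w)%:R * Dlo) <= 4 ^+ K.+1 * be^-1.
    have -> : (b ^ (Jx - j))%:R / ((b ^ w)%:R * Dlo) =
        4 ^+ K.+1 * (be ^+ (r * k.+1 + (Jx - j)) / be ^+ (w + (g.-1 * k + Jx))).
      rewrite /Dlo !natrX -/be !exprD; field.
      by rewrite !nz (lt0r_neq0 be0) expf_neq0 ?pnatr_eq0.
    by rewrite ler_wpM2l ?exprn_ge0 // pow_ratio.
  have Kf : K`!%:R <= K.+1`!%:R :> R by rewrite ler_nat fact_mono.
  have -> : (band_const K)%:R / be = 4 * (2 * K.+1`!%:R * be^-1 + 2 * K.+1`!%:R * be^-1
      + 2 ^+ K.+1 * be^-1 + be^-1 + be^-1) + 8 * (4 ^+ K.+1 * be^-1).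
    by rewrite /band_const natrD !natrM !natrD !natrX natrM; ring.
  have t7 := ler_wpM2r i0 Kf.
  have -> : 4 * (Dup + 2 ^+ k.+1 + (b ^ w)%:R + X + 1) / (b ^ (Jx - j.+1))%:R
     = 4 * (Dup / (b ^ (Jx - j.+1))%:R + X / (b ^ (Jx - j.+1))%:R
       + 2 ^+ k.+1 / (b ^ (Jx - j.+1))%:R + (b ^ w)%:R / (b ^ (Jx - j.+1))%:R
       + 1 / (b ^ (Jx - j.+1))%:R) by ring.
  rewrite -(mulrA 8 _ (_^-1)); move: t1 t2 t3 t4 t5 t6 t7; clear; lra.
have -> : 18 * (b ^ r)%:R * th * nrm f = 9 * (b ^ r)%:R * th * (2 * nrm f) by ring.
have /andP[th0 th1] := th01.
apply: (@le_trans _ _ (9 * (b ^ r)%:R * th ^+ (2 ^ (K - k)) * (2 * nrm f))); last first.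
  rewrite ler_wpM2r ?mulr_ge0 ?nrm_ge0 // ler_wpM2l ?mulr_ge0 //.
  by rewrite -[leRHS]expr1 ler_wiXn2l // expn_gt0.
(* With separation [b^(g.-1)] the discarded pairs of shifts are a proportion of order [1 / b], which
   the hypothesis on [th] covers, as it covers [b^g] against [b^r]. *)
apply: (weyl_iter _ (b ^ g) (b ^ g.-1)) => //.
- by rewrite expn_gt0 b1.
- apply: (@le_trans _ _ ((b ^ r)%:R * ((band_const K)%:R / be))); last by rewrite ler_wpM2l.
  rewrite mulrA ler_pdivlMr // -natrM -natrM ler_nat.
  apply: (@leq_trans (b ^ r * 1)); last by rewrite leq_mul2l (ltnW CK2n) orbT.
  by rewrite muln1 -expnSr leq_pexp2l // /r -add1n leq_add2r.
- apply: (@le_trans _ _ ((b ^ g)%:R * ((band_const K)%:R / be))); last by rewrite ler_wpM2l.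
  rewrite mulrA ler_pdivlMr // -!natrM ler_nat.
  rewrite -mulnA -expnSr (_ : g.-1.+1 = g); last by rewrite /g addnS.
  by rewrite mulnC leq_mul2l CK2n orbT.
Qed.

End BandEstimate.

(** * The divisor bound *)

Section DivisorBound.
Local Open Scope nat_scope.

Definition tau n := size (divisors n).

(** The map from [x] to the pair of [gcdn x a] and [x %/ gcdn x a] injects the divisors of [a * c]
    into pairs of divisors. *)
Lemma tauM a c : 0 < a -> 0 < c -> tau (a * c) <= tau a * tau c.
Proof.
move=> a0 c0; rewrite /tau -(size_allpairs muln); apply: uniq_leq_size.
  exact: divisors_uniq.
move=> x; rewrite -dvdn_divisors ?muln_gt0 ?a0 // => xac.
apply/allpairsP; exists (gcdn x a, x %/ gcdn x a) => /=.
have g0 : 0 < gcdn x a by rewrite gcdn_gt0 a0 orbT.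
rewrite -!dvdn_divisors // dvdn_gcdr; split=> //; last by rewrite mulnC divnK ?dvdn_gcdl.
rewrite -(@Gauss_dvdr _ (a %/ gcdn x a)).
  by rewrite -(dvdn_pmul2r g0) divnK ?dvdn_gcdl // mulnAC divnK ?dvdn_gcdr.
rewrite /coprime -(eqn_pmul2r g0) mul1n; apply/eqP.
by rewrite muln_gcdl !divnK ?dvdn_gcdl ?dvdn_gcdr.
Qed.

Lemma tau_pfactor p e : prime p -> tau (p ^ e) <= e.+1.
Proof.
move=> pp; rewrite /tau -[X in _ <= X](size_mkseq (expn p)).
apply: uniq_leq_size; first exact: divisors_uniq.
move=> x; rewrite -dvdn_divisors ?expn_gt0 ?prime_gt0 // => /(dvdn_pfactor _ _ pp)[i ie ->].
by apply/mapP; exists i => //; rewrite mem_iota.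
Qed.

(** With [x] just above [e.+1 / E], both [e.+1 <= E * x] and [x < 2^x] hold; raise them to the power
    [E]. *)
Lemma pow_le_exp E e : 0 < E -> e.+1 ^ E <= (2 * E) ^ E * 2 * 2 ^ e.
Proof.
move=> E0; pose x := (e.+1 %/ E).+1.
have h1 : e.+1 <= E * x by rewrite mulnC; exact: ltnW (ltn_ceil _ E0).
have h2 : x * E <= e.+1 + E by rewrite mulSn addnC leq_add2r leq_trunc_div.
have h3 : x ^ E <= 2 ^ (e.+1 + E).
  apply: (@leq_trans ((2 ^ x) ^ E)); first by rewrite leq_exp2r // ltnW // ltn_expl.
  by rewrite -expnM leq_exp2l.
apply: (@leq_trans ((E * x) ^ E)); first by rewrite leq_exp2r.
rewrite !expnMn; apply: (@leq_trans (E ^ E * 2 ^ (e.+1 + E))); first by rewrite leq_mul2l h3 orbT.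
by rewrite expnD expnS; lia.
Qed.

(* Only the primes below [2 ^ E] contribute to the constant *)
Lemma tau_bound E : 0 < E -> exists C, forall n, 0 < n -> tau n ^ E <= C * n.
Proof.
move=> E0; pose A := (2 * E) ^ E * 2.
have A0 : 0 < A by rewrite muln_gt0 expn_gt0 muln_gt0 E0.
(* All small divisors are counted, not only primes. Removing the full power of a small prime [q]
   from [n] loses at least the divisor [q], which pays for one factor [A]; a prime from [2^E] on
   costs nothing. *)
pose cnt n := count (fun q => q %| n) (iota 0 (2 ^ E)).
suff h n : 0 < n -> tau n ^ E <= A ^ cnt n * n.
  exists (A ^ (2 ^ E)) => n n0; apply: (leq_trans (h n n0)).
  rewrite leq_mul2r leq_pexp2l ?orbT // /cnt.
  by apply: (leq_trans (count_size _ _)); rewrite size_iota.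
elim/ltn_ind: n => n IH n0.
have [n1|n1] := leqP n 1.
  have -> : n = 1 by lia.
  by rewrite (_ : tau 1 = 1) // exp1n muln1 expn_gt0 A0.
have pp := pdiv_prime n1; set q := pdiv n in pp.
have q1 := prime_gt1 pp.
have [m qm nE] := pfactor_coprime pp n0.
set e := logn q n in nE.
have m0 : 0 < m by move: n0; rewrite {1}nE muln_gt0 => /andP[].
have e0 : 0 < e by rewrite /e logn_gt0 mem_primes pp n0 pdiv_dvd.
have mn : m < n by rewrite {1}nE ltn_Pmulr // -(exp1n e) ltn_exp2r.
have qn : q %| n by exact: pdiv_dvd.
have mdn : m %| n by rewrite {1}nE dvdn_mulr.
have sub : subpred (fun t => t %| m) (fun t => t %| n) by move=> t /dvdn_trans; apply.
have t1 : tau n ^ E <= tau m ^ E * e.+1 ^ E.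
  rewrite -expnMn leq_exp2r // {1}nE.
  apply: (leq_trans (tauM _ _ m0 _)); first by rewrite expn_gt0 prime_gt0.
  by rewrite leq_mul2l tau_pfactor ?orbT.
apply: (leq_trans t1); apply: (leq_trans (leq_mul (IH m mn m0) (leqnn _))).
rewrite [X in _ <= _ * X]nE mulnAC [X in X <= _]mulnC [X in _ <= X]mulnCA leq_mul2l; apply/orP; right.
have [qE|Eq] := leqP (2 ^ E) q.
  apply: leq_mul; first by rewrite leq_pexp2l // sub_count.
  apply: (@leq_trans ((2 ^ E) ^ e)); last by rewrite leq_exp2r.
  by rewrite -expnM mulnC expnM leq_exp2r // ltn_expl.
have cS : (cnt m).+1 <= cnt n.
  have -> : cnt n = count (fun t => t %| m) (iota 0 (2 ^ E)) +
      count (fun t => (t %| n) && ~~ (t %| m)) (iota 0 (2 ^ E)).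
    rewrite /cnt -count_predUI -[LHS]addn0; congr (_ + _).
      apply: eq_count => t /=; have := sub t.
      by case: (t %| m); case: (t %| n) => // /(_ isT).
    by apply/esym/eqP; rewrite -leqn0 leqNgt -has_count; apply/hasPn => t _ /=; case: (t %| m); rewrite ?andbF.
  rewrite -addn1 leq_add2l -has_count; apply/hasP; exists q; first by rewrite mem_iota.
  by rewrite qn -prime_coprime.
apply: (@leq_trans (A ^ (cnt m).+1 * q ^ e)); last by rewrite leq_mul2r leq_pexp2l ?orbT.
rewrite expnS -mulnA mulnCA leq_mul2l; apply/orP; right.
apply: (leq_trans (pow_le_exp E e E0)); rewrite -/A leq_mul2l; apply/orP; right.
by rewrite leq_exp2r.
Qed.
End DivisorBound.

(** * Counting quadruples on the circle *)

Section Cyclic.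
Context {R : realType}.
Variable J : nat.
Hypothesis J1 : (1 < J)%N.

Lemma Zp_natr_inj y y' : (y < J)%N -> (y' < J)%N -> y%:R = y'%:R :> 'Z_J -> y = y'.
Proof.
move=> yJ y'J /(congr1 val); rewrite /= !val_Zp_nat // !modn_small //.
Qed.

Lemma Zp_natJ : J%:R = 0 :> 'Z_J.
Proof. by apply: val_inj; rewrite /= val_Zp_nat // modnn. Qed.

Lemma Zp_int_eq (y z : int) : y%:~R = z%:~R :> 'Z_J -> exists w : int, y = z + w * J%:Z.
Proof.
move=> yz; suff h : exists w : int, y - z = w * J%:Z.
  by case: h => w h; exists w; lia.
have : (y - z)%:~R = 0 :> 'Z_J by rewrite rmorphB /= yz subrr.
set d := y - z.
rewrite {1}(divz_eq d J%:Z) rmorphD rmorphM /= -[J%:Z%:~R]/(J%:R) Zp_natJ mulr0 add0r.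
have J0 : (0 : int) < J%:Z by lia.
have m0 := modz_ge0 d (lt0r_neq0 J0); have mJ := ltz_mod d (lt0r_neq0 J0).
have [r rE] : exists r : nat, (d %% J%:Z)%Z = r%:Z by exists `|(d %% J%:Z)%Z|%N; lia.
rewrite rE -[r%:Z%:~R]/(r%:R) => r0.
have : r = 0%N by apply: Zp_natr_inj; rewrite //; lia.
move=> r0'; exists (d %/ J%:Z)%Z; rewrite {1}(divz_eq d J%:Z) rE r0'; lia.
Qed.

Definition cnt_fun (Q : finType) (P : Q -> 'Z_J) : 'Z_J -> R :=
  fun x => \sum_q (P q == x)%:R.

(** The squared norm counts coincidences between values [P q - y], with weight [l^-2]. Given [q],
    [q'] and [y], at most one [y'] fits because [l <= J], so a near pair contributes at most [l]
    coincidences. *)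
Lemma sqr_nrm_avg_count (Q : finType) (P : Q -> 'Z_J) (near : Q -> Q -> bool) l :
  (0 < l)%N -> (l <= J)%N ->
  (forall q q' y y', (y < l)%N -> (y' < l)%N -> P q - y%:R = P q' - y'%:R -> near q q') ->
  nrm (avg 1 l (cnt_fun Q P)) ^+ 2 <= l%:R^-1 * \sum_q \sum_q' (near q q')%:R.
Proof.
move=> l0 lJ hnear; have lR : 0 < l%:R :> R by rewrite ltr0n.
pose T := (Q * 'I_l)%type.
pose h (t : T) : 'Z_J := P t.1 - (t.2 : nat)%:R.
have hitE x : avg 1 l (cnt_fun Q P) x = l%:R^-1 * \sum_(t : T) (h t == x)%:R.
  rewrite avgE; congr (_ * _); rewrite -(pair_bigA _ (fun q (y : 'I_l) => (P q - y%:R == x)%:R)) /=.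
  rewrite exchange_big /=; apply: eq_bigr => y _; apply: eq_bigr => q _.
  by rewrite subr_eq.
rewrite sqr_nrm /dot.
under eq_bigr do rewrite hitE -expr2 exprMn expr2.
rewrite -mulr_sumr -mulrA ler_wpM2l ?invr_ge0 ?ler0n // ler_pdivrMl //.
have -> : \sum_x (\sum_(t : T) (h t == x)%:R : R) ^+ 2 = \sum_(t : T) \sum_(t' : T) (h t == h t')%:R.
  under eq_bigr do rewrite expr2 mulr_suml.
  rewrite exchange_big /=; apply: eq_bigr => t _.
  under eq_bigr do rewrite mulr_sumr.
  rewrite exchange_big /=; apply: eq_bigr => t' _.
  rewrite (bigD1 (h t)) //= eqxx mul1r big1 ?addr0 1?eq_sym // => x /negPf.
  by rewrite eq_sym => ->; rewrite mul0r.
rewrite -(pair_bigA _ (fun q (y : 'I_l) => \sum_(t' : T) (h (q, y) == h t')%:R)) /=.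
rewrite mulr_sumr; apply: ler_sum => q _.
rewrite mulr_sumr.
under eq_bigr do rewrite -(pair_bigA _ (fun q' (y' : 'I_l) => (h (q, _) == h (q', y'))%:R)) /=.
rewrite exchange_big /=; apply: ler_sum => q' _.
apply: (@le_trans _ _ (\sum_(y < l) (near q q')%:R)); last by rewrite sumr_const card_ord mulr_natl.
apply: ler_sum => y _; case: (boolP (near q q')) => nq; last first.
  rewrite big1 // => y' _; case: eqP => // e.
  by rewrite (hnear _ _ _ _ (ltn_ord y) (ltn_ord y') e) in nq.
case: (pickP (fun y' : 'I_l => h (q, y) == h (q', y'))) => [y0 /eqP e0|none]; last first.
  by rewrite big1 // => y' _; rewrite none.
rewrite (bigD1 y0) //= e0 eqxx big1 ?addr0 // => y' yy0.
case: eqP => // e; case/eqP: yy0; apply: val_inj.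
have lt z : (z < l -> z < J)%N by move=> /leq_trans; apply.
apply: (Zp_natr_inj _ _ (lt _ (ltn_ord y')) (lt _ (ltn_ord y0))).
by move: e; rewrite /h /= => /addrI /oppr_inj.
Qed.

End Cyclic.

Section Logarithms.
Context {R : realType}.

(** Only the tangent inequality for the logarithm is used, at [y / x] and at [x / y]. *)
Lemma exp_close (x y e : R) : 0 < x -> 0 < y -> e <= 2^-1 ->
  `|ln x - ln y| <= e -> `|x - y| <= 2 * e * x /\ y <= 2 * x.
Proof.
move=> x0 y0 e2; rewrite ler_norml => /andP[h1 h2].
have e0 : 0 <= e by lra.
have lnle (u v : R) : 0 < u -> 0 < v -> u - v <= (ln u - ln v) * u.
  move=> u0 v0; have := @le_ln1Dx R (v / u - 1).
  rewrite addrCA subrr addr0 ln_div ?posrE // => h.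
  have := h _; rewrite ltrBrDl subrr divr_gt0 // => /(_ isT).
  rewrite -(ler_pM2r u0) !mulrBl divfK ?lt0r_neq0 // mul1r; lra.
have d1 := lnle x y x0 y0; have d2 := lnle y x y0 x0.
have d3 : (ln y - ln x) * y <= e * y by rewrite ler_wpM2r ?(ltW y0) //; lra.
have d4 : (ln x - ln y) * x <= e * x by rewrite ler_wpM2r ?(ltW x0) //.
have d5 : e * y <= 2^-1 * y by rewrite ler_wpM2r // ltW.
have y2 : y <= 2 * x by lra.
split=> //.
have d6 : e * y <= e * (2 * x) by rewrite ler_wpM2l.
have d7 : 0 <= e * x by rewrite mulr_ge0 // ltW.
by rewrite ler_norml; apply/andP; split; lra.
Qed.

Lemma nat_close (x y : nat) (e : R) : (0 < x)%N -> (0 < y)%N -> e <= 2^-1 ->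
  `|ln x%:R - ln y%:R| <= e -> 2 * e * x%:R < 1 -> x = y.
Proof.
move=> x0 y0 e2 hln ex.
have [] := exp_close x%:R y%:R e _ _ e2 hln; rewrite ?ltr0n // => hxy _.
have := le_lt_trans hxy ex; rewrite ltr_norml => /andP[h1 h2].
apply/eqP; rewrite eqn_leq -ltnS -(ltr_nat R) -[(y <= x)%N]ltnS -(ltr_nat R) -!natr1.
by apply/andP; split; lra.
Qed.

Lemma ln2_gt0 : 0 < ln (2 : R).
Proof. by have := @ln2_ge_half R; lra. Qed.

End Logarithms.

(** * Positions of the quadruples: second moment and density *)

Section Quadruples.
Context {R : realType}.
Variables (J M : nat).
(* Integer part of [J log2 n]: multiplication by [n] is translation by [lam n] in ['Z_J]. *)
Definition lam (n : nat) : int := Num.floor (J%:R / ln 2 * ln n%:R : R).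

Lemma lam_bounds n : (lam n)%:~R <= J%:R / ln (2 : R) * ln (n%:R : R) < (lam n)%:~R + 1.
Proof. by have := floor_itv (J%:R / ln 2 * ln n%:R : R); rewrite intrD. Qed.

(** The last entry runs over [3 M] values so that a window of admissible [d] can begin anywhere
    between [M] and [2 M] and still fit; see [arc_hit]. *)
Definition quad := (('I_M * 'I_M) * ('I_M * 'I_(3 * M)))%type.
Definition qa (q : quad) := (M + q.1.1)%N.
Definition qb (q : quad) := (M + q.1.2)%N.
Definition qc (q : quad) := (M + q.2.1)%N.
Definition qd (q : quad) := (M + q.2.2)%N.

Lemma quad_bounds q : [/\ (M <= qa q < 2 * M)%N, (M <= qb q < 2 * M)%N,
  (M <= qc q < 2 * M)%N & (M <= qd q < 4 * M)%N].
Proof.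
rewrite /qa /qb /qc /qd; case: q => [[a b] [c d]] /=.
have := ltn_ord a; have := ltn_ord b; have := ltn_ord c; have := ltn_ord d.
by move=> *; split; apply/andP; split; lia.
Qed.

Definition pos (q : quad) : int := lam (qc q) + lam (qd q) - lam (qa q) - lam (qb q).
Definition logr (q : quad) : R :=
  ln (qc q)%:R + ln (qd q)%:R - ln (qa q)%:R - ln (qb q)%:R.

Lemma pos_close q : `|(pos q)%:~R - J%:R / ln (2 : R) * logr q| <= 2.
Proof.
rewrite /pos !rmorphB rmorphD /= /logr.
have /andP[? ?] := lam_bounds (qa q); have /andP[? ?] := lam_bounds (qb q).
have /andP[? ?] := lam_bounds (qc q); have /andP[? ?] := lam_bounds (qd q).
by rewrite ler_norml !mulrBr mulrDr; apply/andP; split; lra.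
Qed.

(** Cross multiplication: the ratios [c d / (a b)] of [q] and [q'] agree exactly when
    [qprod q q' = qprod q' q]. *)
Definition qprod (q q' : quad) := (qc q * qd q * (qa q' * qb q'))%N.

(** Shaped for the divisor bound: [c, d] of [q] and [a, b] of [q'] determine [n], and the four other
    entries are divisors of [n]. The factor 64 absorbs the power of 2 by which the two ratios may
    differ. *)
Definition near_div (q q' : quad) := let n := (64 * qprod q q')%N in
  [&& qa q %| n, qb q %| n, qc q' %| n & qd q' %| n]%N.

Hypotheses (J1 : (1 < J)%N) (M0 : (0 < M)%N).

Lemma qprod_bounds q q' : (M ^ 4 <= qprod q q' < 32 * M ^ 4)%N.
Proof.
have [_ _ /andP[c1 c2] /andP[d1 d2]] := quad_bounds q.
have [/andP[a1 a2] /andP[b1 b2] _ _] := quad_bounds q'.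
rewrite /qprod (_ : M ^ 4 = M * M * (M * M))%N; last by rewrite !expnS; lia.
rewrite !leq_mul //=.
rewrite (_ : 32 * (M * M * (M * M)) = (2 * M) * (4 * M) * ((2 * M) * (2 * M)))%N; last by lia.
by rewrite !ltn_mul.
Qed.

Lemma ln_qprod q q' : ln (qprod q q')%:R =
  ln (qc q)%:R + ln (qd q)%:R + ln (qa q')%:R + ln (qb q')%:R :> R.
Proof.
have [/andP[a1 a2] /andP[b1 b2] /andP[c1 c2] /andP[d1 d2]] := quad_bounds q.
have [/andP[a1' a2'] /andP[b1' b2'] _ _] := quad_bounds q'.
rewrite /qprod !natrM !lnM ?posrE ?mulr_gt0 ?ltr0n ?addrA //; lia.
Qed.

(** Coinciding positions put the logarithms of the two cross products within [(l + 4) / J] of each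
    other modulo [ln 2]. As the products are integers below [32 M^4], their quotient is then exactly
    a power of 2. *)
Lemma near_divP l q q' y y' : (64 * M ^ 4 * (l + 4) < J)%N -> (y < l)%N -> (y' < l)%N ->
  (pos q)%:~R - y%:R = (pos q')%:~R - y'%:R :> 'Z_J -> near_div q q'.
Proof.
move=> lJ yl y'l.
rewrite (_ : y%:R = y%:Z%:~R) // (_ : y'%:R = y'%:Z%:~R) // -!rmorphB => /(Zp_int_eq J J1)[w wE].
have JR : 0 < J%:R :> R by rewrite ltr0n; lia.
have l2 := @ln2_gt0 R.
pose e : R := (l + 4)%:R / J%:R.
have e0 : 0 <= e by rewrite divr_ge0.
have close : `|logr q - logr q' - w%:~R * ln 2| <= e.
  have := pos_close q; have := pos_close q'; rewrite !ler_norml => /andP[p1 p2] /andP[p3 p4].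
  have wR : (pos q)%:~R - y%:R = (pos q')%:~R - y'%:R + w%:~R * J%:R :> R.
    have := congr1 (intr : int -> R) wE.
    by rewrite intrD intrM !intrB.
  have yR : y%:R + 1 <= l%:R :> R by rewrite natr1 ler_nat.
  have y'R : y'%:R + 1 <= l%:R :> R by rewrite natr1 ler_nat.
  have := ler0n R y; have := ler0n R y' => y0 y'0.
  have sc : `|J%:R / ln 2 * (logr q - logr q' - w%:~R * ln 2)| <= (l + 4)%:R.
    have -> : J%:R / ln 2 * (logr q - logr q' - w%:~R * ln 2) =
       J%:R / ln 2 * logr q - J%:R / ln 2 * logr q' - w%:~R * J%:R.
      by field; rewrite lt0r_neq0.
    by rewrite natrD ler_norml; apply/andP; split; lra.
  move: sc; rewrite normrM gtr0_norm ?divr_gt0 // -mulrA mulrC -ler_pdivlMr // -/e => sc.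
  have : `|logr q - logr q' - w%:~R * ln 2| <= ln 2 * e.
    by rewrite -ler_pdivrMl.
  move=> h; rewrite -ler_norml; apply: (le_trans h); apply: ler_piMl => //; exact: ln2_le1.
have MR : 64 * M%:R ^+ 4 * e < 1.
  rewrite mulrA ltr_pdivrMr // mul1r -natrX -natrM -natrM ltr_nat.
  exact: lJ.
have [/andP[Pl Pu] /andP[Pl' Pu']] := (qprod_bounds q q', qprod_bounds q' q).
have M4 : (0 < M ^ 4)%N by rewrite expn_gt0 M0.
have P0 : (0 < qprod q q')%N by exact: leq_trans Pl.
have P0' : (0 < qprod q' q)%N by exact: leq_trans Pl'.
have e2 : e <= 2^-1.
  have : 1 <= M%:R ^+ 4 :> R by rewrite -natrX ler1n.
  nra.
have closeP : `|ln (qprod q q')%:R - ln (qprod q' q)%:R - w%:~R * ln 2| <= e.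
  move: close; rewrite !ln_qprod /logr; congr (`| _ | <= _); ring.
have small (n : nat) : (n < 32 * M ^ 4)%N -> 2 * e * n%:R < 1.
  rewrite -(ltr_nat R) natrM natrX => h; apply: le_lt_trans MR.
  have := ler_wpM2l e0 (ltW h); lra.
have lnX v : (0 < v)%N -> forall k, ln (2 ^ k * v)%:R = k%:R * ln 2 + ln v%:R :> R.
  move=> v0 k; rewrite natrM natrX lnM ?posrE ?exprn_gt0 ?ltr0n // lnXn // mulr_natl //.
have dab x : x \in [:: qa q; qb q; qc q'; qd q'] -> (x %| qprod q' q)%N.
  rewrite !inE /qprod => /or4P[] /eqP ->.
  - by rewrite dvdn_mull // dvdn_mulr.
  - by rewrite dvdn_mull // dvdn_mull.
  - by rewrite dvdn_mulr // dvdn_mulr.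
  - by rewrite dvdn_mulr // dvdn_mull.
suff dv : (qprod q' q %| 64 * qprod q q')%N.
  have h x : x \in [:: qa q; qb q; qc q'; qd q'] -> (x %| 64 * qprod q q')%N.
    by move=> /dab /dvdn_trans; apply.
  by rewrite /near_div /= !h ?inE ?eqxx ?orbT.
have [w0|w0] := leP 0 w.
  have [k kE] : exists k : nat, w = k%:Z by exists `|w|%N; lia.
  have E : qprod q q' = (2 ^ k * qprod q' q)%N.
    apply: (nat_close _ _ e) => //; first by rewrite muln_gt0 expn_gt0.
      by move: closeP; rewrite lnX // kE; congr (`| _ | <= _); ring.
    exact: small.
  by rewrite E mulnA dvdn_mull.
have [k kE] : exists k : nat, w = - k%:Z by exists `|w|%N; lia.
have E : qprod q' q = (2 ^ k * qprod q q')%N.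
  apply: (nat_close _ _ e) => //; first by rewrite muln_gt0 expn_gt0.
    move: closeP; rewrite lnX // kE rmorphN -normrN; congr (`| _ | <= _); ring.
  exact: small.
(* Both products lie between [M^4] and [32 M^4], so the power of 2 is below [2^5]. *)
rewrite E dvdn_pmul2r // (_ : 64 = 2 ^ 6)%N // dvdn_exp2l //.
have : (2 ^ k * M ^ 4 < 2 ^ 5 * M ^ 4)%N.
  by apply: leq_ltn_trans Pu'; rewrite E leq_mul2l Pl orbT.
by rewrite ltn_pmul2r // ltn_exp2l // => /ltnW /leqW.
Qed.

Lemma count_divisors m n N : (0 < N)%N -> (\sum_(i < n) (m + i %| N)%N <= tau N)%N.
Proof.
move=> N0; rewrite -(big_mkord xpredT (fun i => nat_of_bool (m + i %| N)%N)).
rewrite (eq_bigr (fun i => if (m + i %| N)%N then 1 else 0)%N) => [|i _]; last by case: ifP.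
rewrite -big_mkcond sum1_count -size_filter -(size_map (addn m)) /tau.
apply: uniq_leq_size.
  by rewrite map_inj_uniq ?filter_uniq ?iota_uniq //; apply: addnI.
move=> x /mapP[i]; rewrite mem_filter => /andP[iN _] ->.
by rewrite -dvdn_divisors.
Qed.

Lemma sum_near_div D : (forall n, (0 < n <= 2 ^ 11 * M ^ 4)%N -> (tau n <= D)%N) ->
  (\sum_(q : quad) \sum_(q' : quad) near_div q q' <= 3 * M ^ 4 * D ^ 4)%N.
Proof.
move=> hD.
pose i n m : nat := (n %| m)%N.
rewrite -(pair_bigA _ (fun (ab : 'I_M * 'I_M) (cd : 'I_M * 'I_(3 * M)) =>
   \sum_(q' : quad) near_div (ab, cd) q'))%N /=.
rewrite exchange_big /=.
apply: (@leq_trans (\sum_(cd : 'I_M * 'I_(3 * M)) \sum_(ab' : 'I_M * 'I_M) D ^ 4))%N; last first.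
  rewrite !sum_nat_const !card_prod !card_ord mulnA leq_mul2r; apply/orP; right.
  by rewrite !expnS expn0; lia.
apply: leq_sum => cd _.
under eq_bigr => ab _.
  rewrite -(pair_bigA _ (fun (ab' : 'I_M * 'I_M) (cd' : 'I_M * 'I_(3 * M)) =>
     nat_of_bool (near_div (ab, cd) (ab', cd')))) /=; over.
rewrite exchange_big /=; apply: leq_sum => ab' _.
pose N := (64 * ((M + cd.1) * (M + cd.2) * ((M + ab'.1) * (M + ab'.2))))%N.
have Nb : (0 < N <= 2 ^ 11 * M ^ 4)%N.
  case: cd ab' @N => [c d] [a b] /=.
  have := ltn_ord a; have := ltn_ord b; have := ltn_ord c; have := ltn_ord d => hd hc hb ha.
  apply/andP; split; first by rewrite !muln_gt0 !addn_gt0 M0.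
  apply: (@leq_trans (64 * ((2 * M) * (4 * M) * ((2 * M) * (2 * M)))))%N.
    by rewrite leq_mul2l /= !leq_mul //; lia.
  by rewrite !expnS expn0; lia.
have N0 : (0 < N)%N by case/andP: Nb.
have tD n : (\sum_(i < n) (M + i %| N)%N <= D)%N by apply: (leq_trans (count_divisors _ _ _ N0)); exact: hD.
have dist n1 n2 (F G : nat -> nat) : (\sum_(p : 'I_n1 * 'I_n2) F p.1 * G p.2 =
    (\sum_(i < n1) F i) * (\sum_(j < n2) G j))%N.
  by rewrite big_distrlr /= (pair_bigA _ (fun (i : 'I_n1) (j : 'I_n2) => F i * G j)%N).
pose ind x : nat := (M + x %| N)%N.
apply: (@leq_trans (\sum_(ab : 'I_M * 'I_M) \sum_(cd' : 'I_M * 'I_(3 * M))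
   (ind ab.1 * ind ab.2) * (ind cd'.1 * ind cd'.2))%N).
  apply: leq_sum => ab _; apply: leq_sum => cd' _.
  rewrite /near_div -/(qprod _ _) /qprod /qa /qb /qc /qd /= -/N /ind.
  by case: (_ %| _)%N; case: (_ %| _)%N; case: (_ %| _)%N; case: (_ %| _)%N.
under eq_bigr do rewrite -big_distrr /= dist.
rewrite -big_distrl /= dist.
by rewrite (_ : D ^ 4 = D * D * (D * D))%N ?leq_mul ?tD // !expnS expn0; lia.
Qed.

Definition posZ (q : quad) : 'Z_J := (pos q)%:~R.
Definition hits : 'Z_J -> R := @cnt_fun R J quad posZ.

Lemma hits_second_moment l D : (0 < l)%N -> (64 * M ^ 4 * (l + 4) < J)%N ->
  (forall n, (0 < n <= 2 ^ 11 * M ^ 4)%N -> (tau n <= D)%N) ->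
  nrm (avg 1 l hits) ^+ 2 <= l%:R^-1 * (3 * M ^ 4 * D ^ 4)%:R.
Proof.
move=> l0 lJ hD.
have M4 : (0 < M ^ 4)%N by rewrite expn_gt0 M0.
apply: (le_trans (sqr_nrm_avg_count J J1 _ _ near_div l l0 _ _)).
- by nia.
- by move=> q q' y y' yl y'l; exact: near_divP lJ yl y'l.
rewrite ler_wpM2l ?invr_ge0 //.
under eq_bigr do rewrite -natr_sum.
by rewrite -natr_sum ler_nat sum_near_div.
Qed.

(** The integers wanted fill the interval from [x = 2^(t/J)], which lies between [M] and [2 M], to
    [x 2^(l/J)]. Its length is at least [2 n1] because [2 ln 2 >= 1], so [n1] consecutive integers
    fit strictly inside. *)
Lemma arc_hit mu l n1 (t : nat) : M = (2 ^ mu)%N -> (4 * n1 * J = M * l)%N -> (l <= J)%N ->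
  (J * mu <= t < J * mu + J)%N ->
  exists d0 : nat, [/\ (M <= d0)%N, (d0 + n1 <= 4 * M)%N &
    forall i, (i < n1)%N -> exists2 y, (y < l)%N & lam (d0 + i) = (t + y)%:Z].
Proof.
move=> Mmu n1l lJ /andP[t1 t2].
have l2 := @ln2_gt0 R; have JR : 0 < J%:R :> R by rewrite ltr0n; lia.
pose z : R := t%:R * ln 2 / J%:R.
pose x := expR z.
have x0 : 0 < x by exact: expR_gt0.
have MR : M%:R = expR (mu%:R * ln 2) :> R.
  by rewrite -[_ * ln 2]/(mu%:R * _) expRM_natl lnK ?posrE // Mmu natrX.
have xM : M%:R <= x.
  rewrite MR ler_expR /z mulrAC ler_wpM2r ?(ltW l2) // ler_pdivlMr // -natrM ler_nat mulnC.
  exact: t1.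
have xM2 : x <= 2 * M%:R.
  have -> : 2 * M%:R = expR (ln 2 + mu%:R * ln 2) :> R by rewrite expRD -MR lnK ?posrE.
  rewrite ler_expR /z mulrAC -[X in X + _]mul1r -mulrDl ler_wpM2r ?(ltW l2) //.
  by rewrite ler_pdivrMr // mulrDl mul1r -natrM -natrD ler_nat; lia.
exists (Num.truncn x).+1.
have /andP[tx1 tx2] := truncn_itv (ltW x0).
have lnx : J%:R / ln 2 * ln x = t%:R.
  by rewrite /x expRK /z; field; rewrite !lt0r_neq0.
have n1M : (n1 <= M)%N by nia.
split.
- by rewrite -(ler_nat R) ltW // (le_lt_trans xM).
- have : ((Num.truncn x) <= 2 * M)%N by rewrite -(ler_nat R) natrM (le_trans tx1).
  have : (1 <= M)%N by []; lia.
move=> i i1.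
set d := ((Num.truncn x).+1 + i)%N.
have d0 : 0 < d%:R :> R by rewrite ltr0n.
have xd : x < d%:R by apply: (lt_le_trans tx2); rewrite ler_nat leq_addr.
have dx : d%:R < x * expR (l%:R * ln 2 / J%:R).
  have e1 := expR_ge1Dx (l%:R * ln (2 : R) / J%:R).
  have h1 : 4 * n1%:R <= 2 * (x * (l%:R * ln 2 / J%:R)).
    have -> : 4 * n1%:R = M%:R * (l%:R / J%:R) :> R.
      rewrite mulrA; apply/eqP; rewrite eq_sym -(inj_eq (mulIf (lt0r_neq0 JR))) divfK ?lt0r_neq0 //.
      by rewrite -!natrM n1l.
    have -> : 2 * (x * (l%:R * ln 2 / J%:R)) = (2 * ln 2 * x) * (l%:R / J%:R) by ring.
    rewrite ler_wpM2r ?divr_ge0 //; have := @ln2_ge_half R; nra.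
  have h2 : d%:R <= x + n1%:R.
    have : i%:R + 1 <= n1%:R :> R by rewrite natr1 ler_nat.
    by rewrite /d addSnnS natrD -natr1; lra.
  have h3 := ler_wpM2l (ltW x0) e1.
  have : 1 <= n1%:R :> R by rewrite ler1n (leq_ltn_trans (leq0n i) i1).
  lra.
have lo : t%:R < J%:R / ln (2 : R) * ln (d%:R : R).
  by rewrite -lnx ltr_pM2l ?divr_gt0 // ltr_ln ?posrE.
have hi : J%:R / ln (2 : R) * ln (d%:R : R) < (t + l)%:R.
  have -> : (t + l)%:R = J%:R / ln 2 * ln (x * expR (l%:R * ln 2 / J%:R)).
    rewrite lnM ?posrE ?expR_gt0 // expRK mulrDr lnx natrD; congr (_ + _).
    by field; rewrite !lt0r_neq0.
  by rewrite ltr_pM2l ?divr_gt0 // ltr_ln ?posrE // mulr_gt0 ?expR_gt0.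
have f1 : (t%:Z <= lam d)%R by rewrite /lam floor_ge_int ltW.
have f2 : (lam d < (t + l)%:Z)%R by rewrite /lam floor_lt_int.
by exists `|lam d - t%:Z|%N; move: f1 f2; clear; lia.
Qed.

(** For each of the [M^3] choices of [a, b, c], the remaining condition places [lam d] in an arc of
    [l] cells modulo [J], and [arc_hit] supplies [n1 = M l / (4 J)] values of [d]. *)
Lemma hits_density mu l n1 x : M = (2 ^ mu)%N -> (4 * n1 * J = M * l)%N ->
  (0 < l <= J)%N -> M%:R ^+ 4 / (4 * J%:R) <= avg 1 l hits x.
Proof.
move=> Mmu n1l /andP[l0 lJ].
have JR : 0 < J%:R :> R by rewrite ltr0n; lia.
have lR : 0 < l%:R :> R by rewrite ltr0n.
have -> : avg 1 l hits x = l%:R^-1 * \sum_(y < l) \sum_q (posZ q == x + y%:R)%:R.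
  by rewrite avgE.
have -> : M%:R ^+ 4 / (4 * J%:R) = l%:R^-1 * (M%:R ^+ 3 * n1%:R) :> R.
  have e : 4 * n1%:R * J%:R = M%:R * l%:R :> R by rewrite -!natrM n1l.
  apply: (mulIf (lt0r_neq0 JR)); apply: (mulIf (lt0r_neq0 lR)).
  have -> : l%:R^-1 * (M%:R ^+ 3 * n1%:R) * J%:R * l%:R = M%:R ^+ 3 / 4 * (4 * n1%:R * J%:R) :> R.
    by field; rewrite lt0r_neq0.
  by rewrite e; field; rewrite lt0r_neq0.
rewrite ler_wpM2l ?invr_ge0 // exchange_big /=.
rewrite -(pair_bigA _ (fun (ab : 'I_M * 'I_M) (cd : 'I_M * 'I_(3 * M)) =>
   \sum_(y < l) (posZ (ab, cd) == x + y%:R)%:R)) /=.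
have -> : M%:R ^+ 3 * n1%:R = \sum_(ab : 'I_M * 'I_M) \sum_(c < M) n1%:R :> R.
  rewrite !sumr_const card_prod !card_ord -!mulrnA -natrX -natrM; congr (1 *+ _).
  by clear; rewrite !expnS expn0; lia.
apply: ler_sum => -[a b] _.
rewrite -(pair_bigA _ (fun (c : 'I_M) (d : 'I_(3 * M)) =>
   \sum_(y < l) (posZ ((a, b), (c, d)) == x + y%:R)%:R)) /=.
apply: ler_sum => c _.
pose ka : int := lam (M + c) - lam (M + a) - lam (M + b).
pose v : nat := val (x - ka%:~R).
have vJ : (v < J)%N by rewrite /v -[X in (_ < X)%N]Zp_cast // ltn_ord.
have [|d0 [d1 d2 d3]] := arc_hit mu l n1 (J * mu + v) Mmu n1l lJ.
  by rewrite leq_addr ltn_add2l.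
have dlt (i : 'I_n1) : (d0 + i - M < 3 * M)%N by have := ltn_ord i; lia.
pose del (i : 'I_n1) := Ordinal (dlt i).
have del_inj : injective del.
  by move=> i j /(congr1 val) /= e; apply: val_inj => /=; lia.
have tE : (J * mu + v)%:R = x - ka%:~R :> 'Z_J.
  by rewrite natrD natrM Zp_natJ // mul0r add0r natr_Zp.
pose F (d : 'I_(3 * M)) : R := \sum_(y < l) (posZ ((a, b), (c, d)) == x + y%:R)%:R.
rewrite -[leRHS]/(\sum_d F d).
have F0 d : 0 <= F d by apply: sumr_ge0.
apply: (@le_trans _ _ (\sum_(d in [set del i | i : 'I_n1]) F d)); last first.
  rewrite [leRHS](bigID (mem [set del i | i : 'I_n1])) /= lerDl.
  by apply: sumr_ge0.
rewrite big_imset /=; last by move=> i j _ _ /del_inj.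
rewrite -[leLHS]mulr1 -[X in X%:R * 1](card_ord n1) mulr_natl -sumr_const.
apply: ler_sum => i _.
have [y yl ly] := d3 i (ltn_ord i).
rewrite /F (bigD1 (Ordinal yl)) //= (_ : _ == _) ?lerDl ?sumr_ge0 //.
apply/eqP; rewrite /posZ /pos /qc /qd /qa /qb /=.
have -> : (M + (d0 + i - M) = d0 + i)%N by lia.
rewrite ly (_ : _ - lam (M + b) = ka + (J * mu + v + y)%:Z); last by rewrite /ka; lia.
rewrite rmorphD /= -pmulrn natrD tE; ring.
Qed.

End Quadruples.

(** The quotient in Chebyshev's inequality. The loss [D^4 rho^4] that [th^2] has to beat appears
    here. *)
Lemma bad_ratio {R : numFieldType} (B M l th D rho m : R) :
  B != 0 -> M != 0 -> l != 0 -> rho != 0 ->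
  let J := rho ^+ 4 * M ^+ 4 * l in
  (4 * m * (18 * B * th)) ^+ 2 * (l^-1 * (3 * M ^+ 4 * D ^+ 4)) /
    (B * (M ^+ 4 / (4 * J))) ^+ 2
  = J * (48 * (72 * m) ^+ 2 * th ^+ 2 * D ^+ 4 * rho ^+ 4).
Proof.
move=> B0 M0 l0 rho0 J; rewrite /J; field.
by rewrite l0 M0 rho0 B0.
Qed.

(** * Exceptional cells *)

Section BadCells.
Context {R : realType}.
Variables (p K m b rho mu n1 D : nat) (th : R).
Let g := (2 * K + 5)%N.
Let r := (p + g)%N.
Let Jx := (4 * m + r + 1)%N.
Let J := (b ^ Jx)%N.
Let M := (2 ^ mu)%N.
Let l := (b ^ r.+1)%N.

Definition shifts (u : nat) : 'Z_J := (@lam R J (b ^ r + u))%:~R.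
(** Of the two smoothings, the inner one gives access to the second moment, and the outer one is the
    finest member of the family of scales that telescopes. *)
Definition weight : 'Z_J -> R :=
  tsum (b ^ r) shifts (avg 1 l (avg 1 l (@hits R J M))).

Hypotheses (p0 : (0 < p)%N) (b4 : (4 ^ K.+2 <= b)%N) (Kb : (K <= b)%N)
  (mK : ((4 * m) %/ p <= K)%N) (bM : (b ^ m = rho * M)%N) (rho8 : (8 <= rho)%N)
  (Mn1 : (M = 4 * n1 * b ^ g.-1)%N) (gm : (g.-1 <= 4 * m)%N)
  (hD : forall n, (0 < n <= 2 ^ 11 * M ^ 4)%N -> (tau n <= D)%N)
  (th01 : 0 <= th <= 1) (hth : (band_const K)%:R / b%:R <= th ^+ (2 ^ K)).

Let b2 : (1 < b)%N.
Proof. by apply: leq_trans b4; rewrite expnS; have := expn_gt0 4 K.+1; lia. Qed.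

Let J1 : (1 < J)%N.
Proof. by rewrite /J -(expn0 b) ltn_exp2l // /Jx addn1. Qed.

Let M0 : (0 < M)%N. Proof. by rewrite expn_gt0. Qed.

Lemma lam_phase u :
  `|(@lam R J (b ^ r + u))%:~R - J%:R / ln 2 * ln ((b ^ r)%:R + u%:R)| <= 1 :> R.
Proof.
have := @lam_bounds R J (b ^ r + u); rewrite natrD => /andP[? ?].
by rewrite ler_norml; apply/andP; split; lra.
Qed.

Lemma telescoped_bands (f : 'Z_J -> R) j : (g.-1 <= j <= 4 * m)%N ->
  nrm (tsum (b ^ r) shifts (avg 1 (b ^ (Jx - j)) f)
     - tsum (b ^ r) shifts (avg 1 (b ^ (Jx - g.-1)) f))
  <= (j - g.-1)%:R * (18 * (b ^ r)%:R * th * nrm f).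
Proof.
have [l1 l2] := (@ln2_ge_half R, @ln2_le1 R).
elim: j => [|j IH] /andP[gj jm].
  by move: gj; rewrite leqn0 => /eqP ->; rewrite subrr nrm0 mul0r.
have [->|gj'] := eqVneq j.+1 g.-1; first by rewrite subrr nrm0 subnn mul0r.
have gj1 : (g.-1 <= j)%N by move: gj; rewrite leq_eqVlt eq_sym (negPf gj').
rewrite subSn // -natr1 mulrDl mul1r [leRHS]addrC.
apply: (le_trans (nrm_trans (tsum (b ^ r) shifts (avg 1 (b ^ (Jx - j)) f)) _ _)).
apply: lerD; last by apply: IH; rewrite gj1 ltnW.
rewrite -tsumB.
apply: (@band_estimate R _ 1 p K (4 * m) b (fun u => @lam R J (b ^ r + u)) (J%:R / ln 2)) => //.
- by rewrite gj1.
- by apply: leq_trans mK; rewrite leq_div2r // (leq_trans (leq_subr _ _)) // ltnW.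
- have J0 : 0 < J%:R :> R by rewrite ltr0n; move: J1; lia.
  rewrite -/J; apply/andP; split.
    by rewrite ler_pdivlMr ?ln2_gt0 // ler_piMr.
  rewrite ler_pdivrMr ?ln2_gt0 // mulrC mulrA ler_peMl //; lra.
- exact: lam_phase.
Qed.

(** The coarse version [Y] of [weight] is at least [c0] everywhere, so on a bad cell [weight - Y] is
    at least [c0] in absolute value. Chebyshev's inequality compares this with the norm of
    [weight - Y], a sum of band estimates. *)
Lemma bad_count : #|[pred x | weight x <= 0]|%:R <=
  J%:R * (48 * (72 * m%:R) ^+ 2 * th ^+ 2 * D%:R ^+ 4 * rho%:R ^+ 4).
Proof.
pose f := avg 1 l (@hits R J M).
pose Y := tsum (b ^ r) shifts (avg 1 (b ^ (Jx - g.-1)) f).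
pose c0 : R := (b ^ r)%:R * (M%:R ^+ 4 / (4 * J%:R)).
have b0 : (0 < b)%N by exact: ltnW.
have JR : 0 < J%:R :> R by rewrite ltr0n ltnW.
have MR : 0 < M%:R :> R by rewrite ltr0n.
have bR : 0 < (b ^ r)%:R :> R by rewrite ltr0n expn_gt0 b0.
have l0 : (0 < l)%N by rewrite expn_gt0 b0.
have lR : 0 < l%:R :> R by rewrite ltr0n.
have Jl : (J = rho ^ 4 * M ^ 4 * l)%N.
  by rewrite -expnMn -bM -expnM /J /l -expnD; congr (b ^ _)%N; rewrite /Jx; lia.
have c0_gt0 : 0 < c0 by rewrite mulr_gt0 // divr_gt0 ?exprn_gt0 // mulr_gt0.
have Yc x : c0 <= Y x.
  have dens z : M%:R ^+ 4 / (4 * J%:R) <= avg 1 (b ^ (Jx - g.-1)) (@hits R J M) z.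
    apply: (@hits_density R J M J1 M0 mu _ n1) => //.
      rewrite {1}Mn1 -[RHS]mulnA -expnD /J; congr (_ * b ^ _)%N.
      by move: gm; rewrite /Jx; clear; lia.
    by rewrite expn_gt0 b0 /J leq_pexp2l // leq_subr.
  (* After commuting the two smoothings, [Y] is a sum of averages of the coarse smoothing of [hits],
     to which [dens] applies pointwise. *)
  rewrite /Y /f avgC tsumE.
  have -> : c0 = \sum_(u < b ^ r) M%:R ^+ 4 / (4 * J%:R).
    by rewrite sumr_const card_ord -[RHS]mulr_natl.
  apply: ler_sum => u _; rewrite avgE.
  rewrite ler_pdivlMl //; set X := _ / _.
  have -> : l%:R * X = \sum_(y < l) X by rewrite sumr_const card_ord mulr_natl.
  by apply: ler_sum => y _.
have f2 : nrm f ^+ 2 <= l%:R^-1 * (3 * M ^ 4 * D ^ 4)%:R.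
  apply: (@hits_second_moment R J M J1 M0) => //.
  have M4 : (0 < M ^ 4)%N by rewrite expn_gt0 M0.
  have r4 : (8 ^ 4 <= rho ^ 4)%N by rewrite leq_exp2r.
  rewrite Jl (_ : 64 * M ^ 4 * (l + 4) = M ^ 4 * (64 * (l + 4)))%N; last by ring.
  rewrite (_ : rho ^ 4 * M ^ 4 * l = M ^ 4 * (rho ^ 4 * l))%N; last by ring.
  rewrite ltn_pmul2l //; apply: (@leq_trans (8 ^ 4 * l)); last by rewrite leq_mul2r r4 orbT.
  by rewrite (_ : 8 ^ 4 = 4096)%N //; move: l0; clear; lia.
have diff : nrm (weight - Y) <= (4 * m)%:R * (18 * (b ^ r)%:R * th * nrm f).
  have -> : weight = tsum (b ^ r) shifts (avg 1 (b ^ (Jx - 4 * m)) f).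
    by rewrite /weight /f /l; congr (tsum _ _ (avg 1 (b ^ _) _)); rewrite /Jx -addnA addKn addn1.
  apply: (le_trans (telescoped_bands f (4 * m) _)); first by rewrite gm leqnn.
  rewrite ler_wpM2r ?ler_nat ?leq_subr // !mulr_ge0 ?nrm_ge0 //.
  by case/andP: th01.
have cheb : #|[pred x | weight x <= 0]|%:R * c0 ^+ 2 <= nrm (weight - Y) ^+ 2.
  rewrite sqr_nrm mulr_natl -sumr_const /dot.
  rewrite [leRHS](bigID (mem [pred x | weight x <= 0])) /= -[leLHS]addr0 lerD //.
    apply: ler_sum => x; rewrite inE => wx; rewrite -expr2.
    have -> : (weight - Y) x = - (Y x - weight x) by rewrite opprB.
    rewrite sqrrN lerXn2r ?nnegrE ?(ltW c0_gt0) //; have := Yc x; lra.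
  by apply: sumr_ge0 => x _; rewrite -expr2 sqr_ge0.
have up : nrm (weight - Y) ^+ 2 <= ((4 * m)%:R * (18 * (b ^ r)%:R * th)) ^+ 2 * (l%:R^-1 * (3 * M ^ 4 * D ^ 4)%:R).
  apply: (@le_trans _ _ (((4 * m)%:R * (18 * (b ^ r)%:R * th)) ^+ 2 * nrm f ^+ 2)).
    have th0 : 0 <= th by case/andP: th01.
    rewrite -exprMn -(mulrA (4 * m)%:R) lerXn2r ?nnegrE ?nrm_ge0 //.
    by rewrite !mulr_ge0 ?nrm_ge0.
  by rewrite ler_wpM2l ?sqr_ge0.
have := le_trans cheb up; rewrite -ler_pdivlMr ?exprn_gt0 // => h; apply: (le_trans h).
rewrite le_eqVlt; apply/orP; left; apply/eqP.
have JE : J%:R = rho%:R ^+ 4 * M%:R ^+ 4 * l%:R :> R by rewrite Jl !natrM !natrX.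
have -> : (4 * m)%:R = 4 * m%:R :> R by rewrite natrM.
have -> : (3 * M ^ 4 * D ^ 4)%:R = 3 * M%:R ^+ 4 * D%:R ^+ 4 :> R by rewrite !natrM !natrX.
have rR : 0 < rho%:R :> R by rewrite ltr0n (leq_trans _ rho8).
rewrite /c0 JE; apply: bad_ratio; exact: lt0r_neq0.
Qed.

End BadCells.

(** * From a positive weight to a good rational approximation *)

Section Solution.
Context {R : realType}.

(** The strict inequalities keep [a - b] and [c - d] positive, as the two values of the form
    require. *)
Definition approx_sol (al X E : R) := exists a b c d : nat,
  [/\ (0 < b < a)%N, (0 < d < c)%N, a%:R <= X, c%:R <= X
    & `|al * (a * b)%:R - (c * d)%:R| <= E].

Variables (p K m b rho mu : nat).
Let g := (2 * K + 5)%N.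
Let r := (p + g)%N.
Let Jx := (4 * m + r + 1)%N.
Let J := (b ^ Jx)%N.
Let M := (2 ^ mu)%N.
Let l := (b ^ r.+1)%N.
Let L := (b ^ r)%N.

Hypotheses (b4 : (4 ^ K.+2 <= b)%N) (bM : (b ^ m = rho * M)%N) (rho8 : (8 <= rho)%N).

Definition cell (al : R) : nat := Num.truncn (J%:R / ln 2 * ln al).

Let b16 : (16 <= b)%N.
Proof. by apply: leq_trans b4; rewrite -[16%N]/(4 ^ 2)%N leq_exp2l. Qed.

Lemma weight_pos x : 0 < @weight R p K m b mu x -> exists u y y' q,
  [/\ (u < L)%N, (y < l)%N, (y' < l)%N & posZ (R := R) J M q = x + @shifts R p K m b u + y%:R + y'%:R].
Proof.
have ex_pos n (F : nat -> R) : 0 < \sum_(i < n) F i -> exists2 i, (i < n)%N & 0 < F i.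
  move=> h; apply: contrapT => none; move: h; rewrite ltNge; apply/negP/negPn.
  by apply: sumr_le0 => i _; rewrite leNgt; apply/negP => Fi; apply: none; exists i.
have l0 : 0 < l%:R^-1 :> R by rewrite invr_gt0 ltr0n expn_gt0; move: b16; case: (b).
rewrite /weight tsumE.
move=> /(ex_pos _ (fun u => avg 1 l (avg 1 l (@hits R J M)) (x + @shifts R p K m b u)))[u uL].
set z := x + _.
rewrite avgE pmulr_rgt0 // => /(ex_pos _ (fun y => avg 1 l (@hits R J M) (z + y%:R)))[y yl].
rewrite avgE pmulr_rgt0 // => /(ex_pos _ (fun y' => @hits R J M (z + y%:R + y'%:R)))[y' y'l].
rewrite /hits /cnt_fun => h.
have [q hq] : exists q, posZ (R := R) J M q = x + @shifts R p K m b u + y%:R + y'%:R.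
  apply: contrapT => none; move: h; rewrite ltNge; apply/negP/negPn.
  apply: sumr_le0 => q _; case: eqP => // e.
  by case: none; exists q.
by exists u, y, y', q.
Qed.

(** A positive weight yields a quadruple with [c d / (a b)] close to [al v] up to a power of 2. The
    multiplier [v] is moved into [a], and the power of 2 into [c]. *)
Lemma weight_sol al : 1 <= al < 2 -> 0 < @weight R p K m b mu (cell al)%:R ->
  approx_sol al (32 * (L * M)%:R) (L%:R / M%:R ^+ 2).
Proof.
move=> /andP[al1 al2] /weight_pos[u [y [y' [q [uL yl y'l]]]]].
have al0 : 0 < al by lra.
have b0 : (0 < b)%N by apply: leq_trans b16.
have J1 : (1 < J)%N by rewrite /J -(expn0 b) ltn_exp2l ?(leq_trans _ b16) // /Jx addn1.
have JR : 0 < J%:R :> R by rewrite ltr0n ltnW.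
have M0 : (0 < M)%N by rewrite expn_gt0.
have MR : 0 < M%:R :> R by rewrite ltr0n.
have L0 : (0 < L)%N by rewrite expn_gt0 b0.
have LR : 0 < L%:R :> R by rewrite ltr0n.
have L256 : (256 <= L)%N.
  apply: (@leq_trans (b ^ 2)); first by rewrite -[256%N]/(16 ^ 2)%N leq_exp2r.
  by rewrite leq_pexp2l // /r /g; lia.
have l2 := @ln2_gt0 R.
have l0 : (0 < l)%N by rewrite expn_gt0 b0.
have Jl : (J = rho ^ 4 * M ^ 4 * l)%N.
  by rewrite -expnMn -bM -expnM /J /l -expnD; congr (b ^ _)%N; rewrite /Jx; lia.
rewrite /posZ /shifts.
rewrite -[(cell al)%:R]/((cell al)%:Z%:~R) -[y%:R]/(y%:Z%:~R) -[y'%:R]/(y'%:Z%:~R) -!rmorphD.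
move=> /(Zp_int_eq J J1)[w wE].
set v := (L + u)%N in wE.
have vL : (L <= v < 2 * L)%N by rewrite /v leq_addr mul2n -addnn ltn_add2l.
have [/andP[a1 a2] /andP[b1 b2] /andP[c1 c2] /andP[d1 d2]] := quad_bounds M q.
have x0 : 0 <= J%:R / ln 2 * ln al by rewrite mulr_ge0 ?ln_ge0 // ltW // divr_gt0.
have /andP[x1 x2] := truncn_itv x0; rewrite -/(cell al) -natr1 in x1 x2.
pose e : R := (2 * l + 4)%:R / J%:R.
have close : `|logr (R := R) M q - ln al - ln v%:R - w%:~R * ln 2| <= e.
  have := @pos_close R J M q; rewrite ler_norml => /andP[p1 p2].
  have /andP[v1 v2] := @lam_bounds R J v.
  have wR : (@pos R J M q)%:~R = (cell al)%:R + (@lam R J v)%:~R + y%:R + y'%:R + w%:~R * J%:R :> R.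
    by have := congr1 (intr : int -> R) wE; rewrite !intrD intrM.
  have yR : y%:R + 1 <= l%:R :> R by rewrite natr1 ler_nat.
  have y'R : y'%:R + 1 <= l%:R :> R by rewrite natr1 ler_nat.
  have := ler0n R y; have := ler0n R y' => y0 y'0.
  have sc : `|J%:R / ln 2 * (logr (R := R) M q - ln al - ln v%:R - w%:~R * ln 2)| <= (2 * l + 4)%:R.
    have -> : J%:R / ln 2 * (logr (R := R) M q - ln al - ln v%:R - w%:~R * ln 2) =
       J%:R / ln 2 * logr M q - J%:R / ln 2 * ln al - J%:R / ln 2 * ln v%:R - w%:~R * J%:R.
      by field; rewrite lt0r_neq0.
    by rewrite natrD natrM ler_norml; apply/andP; split; lra.
  move: sc; rewrite normrM gtr0_norm ?divr_gt0 // -mulrA mulrC -ler_pdivlMr // -/e => sc.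
  have h : `|logr (R := R) M q - ln al - ln v%:R - w%:~R * ln 2| <= ln 2 * e.
    by rewrite -ler_pdivrMl.
  apply: (le_trans h); apply: ler_piMl; last exact: ln2_le1.
  by rewrite divr_ge0.
have eE : e <= 6 / (rho%:R ^+ 4 * M%:R ^+ 4).
  have lR : 1 <= l%:R :> R by rewrite ler1n.
  have lR0 : 0 < l%:R :> R by rewrite ltr0n.
  have rR : 0 < rho%:R :> R by rewrite ltr0n (leq_trans _ rho8).
  have JE : J%:R = rho%:R ^+ 4 * M%:R ^+ 4 * l%:R :> R by rewrite Jl !natrM !natrX.
  rewrite /e JE natrD natrM ler_pdivrMr ?mulr_gt0 ?exprn_gt0 //.
  have -> : 6 / (rho%:R ^+ 4 * M%:R ^+ 4) * (rho%:R ^+ 4 * M%:R ^+ 4 * l%:R) = 6 * l%:R :> R.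
    by field; rewrite !lt0r_neq0.
  lra.
have rR8 : 8 <= rho%:R :> R by rewrite ler_nat.
have rho4 : 384 <= rho%:R ^+ 4 :> R.
  have h2 : 64 <= rho%:R * rho%:R :> R by move: rR8; nra.
  have -> : rho%:R ^+ 4 = rho%:R * rho%:R * (rho%:R * rho%:R) :> R by ring.
  by move: h2; nra.
have M1 : 1 <= M%:R :> R by rewrite ler1n.
have eM : e * M%:R ^+ 4 <= 64^-1.
  apply: (le_trans (ler_wpM2r _ eE)); first by rewrite exprn_ge0 // ltW.
  have rR : 0 < rho%:R :> R by rewrite ltr0n (leq_trans _ rho8).
  have -> : 6 / (rho%:R ^+ 4 * M%:R ^+ 4) * M%:R ^+ 4 = 6 / rho%:R ^+ 4 :> R.
    by field; rewrite !lt0r_neq0.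
  by rewrite ler_pdivrMr ?exprn_gt0 //; move: rho4; lra.
have M4 : 1 <= M%:R ^+ 4 :> R by rewrite exprn_ege1.
have e0 : 0 <= e by rewrite divr_ge0.
have e2 : e <= 2^-1 by nra.
set qa' := qa M q in a1 a2 *; set qb' := qb M q in b1 b2 *.
set qc' := qc M q in c1 c2 *; set qd' := qd M q in d1 d2 *.
have logrE : logr (R := R) M q = ln qc'%:R + ln qd'%:R - ln qa'%:R - ln qb'%:R by [].
have aR : 0 < qa'%:R :> R by rewrite ltr0n (leq_trans M0).
have bR : 0 < qb'%:R :> R by rewrite ltr0n (leq_trans M0).
have cR : 0 < qc'%:R :> R by rewrite ltr0n (leq_trans M0).
have dR : 0 < qd'%:R :> R by rewrite ltr0n (leq_trans M0).
have [vL1 vL2] := andP vL.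
have vR : 0 < v%:R :> R by rewrite ltr0n (leq_trans L0).
have lnX k : ln (2 ^+ k) = k%:R * ln 2 :> R by rewrite lnXn // mulr_natl.
pose X : R := al * (v * qa' * qb')%:R.
have X0 : 0 < X by rewrite mulr_gt0 // !natrM !mulr_gt0.
have lnXE : ln X = ln al + ln v%:R + ln qa'%:R + ln qb'%:R.
  by rewrite /X !natrM !lnM ?posrE ?mulr_gt0 // !addrA.
have cd0 : 0 < qc'%:R * qd'%:R :> R by rewrite mulr_gt0.
have lncd : ln (qc'%:R * qd'%:R) = ln qc'%:R + ln qd'%:R :> R by rewrite lnM ?posrE.
have pow0 k : 0 < 2 ^+ k :> R by rewrite exprn_gt0.
have XL : L%:R * M%:R * M%:R <= X.
  have h : L%:R * M%:R * M%:R <= (v * qa' * qb')%:R :> R by rewrite -!natrM ler_nat !leq_mul.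
  by apply: (le_trans h); rewrite ler_peMl.
have XU : X <= 16 * (L%:R * M%:R * M%:R).
  have h : (v * qa' * qb')%:R <= (2 * L * (2 * M) * (2 * M))%:R :> R.
    by rewrite ler_nat !leq_mul // ltnW.
  apply: (@le_trans _ _ (2 * (2 * L * (2 * M) * (2 * M))%:R)).
    by apply: ler_pM => //; rewrite ltW.
  by rewrite !natrM; lra.
have cdU : qc'%:R * qd'%:R <= 8 * (M%:R * M%:R) :> R.
  by rewrite -!natrM ler_nat; apply: (leq_trans (leq_mul (ltnW c2) (ltnW d2))); clear; lia.
have LR' : 256 <= L%:R :> R by rewrite ler_nat.
have MM : 0 < M%:R * M%:R :> R by rewrite mulr_gt0.
have LMM : 256 * (M%:R * M%:R) <= L%:R * M%:R * M%:R :> R by rewrite -mulrA ler_wpM2r // ltW.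
(* Since [X] is at least [256 M^2] and [c d] at most [8 M^2], the power of 2 can only enlarge
   [c d]. *)
have w0 : w <= 0.
  rewrite leNgt; apply/negP => w_gt0.
  have [k kE] : exists k : nat, w = k.+1%:Z by exists `|w|.-1%N; move: w_gt0; clear; lia.
  have [|_] := @exp_close R (qc'%:R * qd'%:R) (X * 2 ^+ k.+1) e cd0 (mulr_gt0 X0 (pow0 _)) e2 _.
    rewrite lncd lnM ?posrE // lnXE lnX; move: close; rewrite logrE kE.
    by apply: le_trans; rewrite le_eqVlt; apply/orP; left; apply/eqP; congr (`| _ |); rewrite -pmulrn; ring.
  have h1 : X <= X * 2 ^+ k.+1 by rewrite ler_peMr ?(ltW X0) // exprn_ege1 // ler1n.
  lra.
have [k kE] : exists k : nat, w = - k%:Z by exists `|w|%N; move: w0; clear; lia.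
have cdk0 : 0 < qc'%:R * qd'%:R * 2 ^+ k :> R by rewrite mulr_gt0.
have lnd : `|ln X - ln (qc'%:R * qd'%:R * 2 ^+ k)| <= e.
  rewrite lnM ?posrE // lncd lnXE lnX -normrN; move: close; rewrite logrE kE.
  apply: le_trans; rewrite le_eqVlt; apply/orP; left; apply/eqP; congr (`| _ |).
  by rewrite rmorphN /= -pmulrn; ring.
have [diff up] := exp_close _ _ _ X0 cdk0 e2 lnd.
have lnd' : `|ln (qc'%:R * qd'%:R * 2 ^+ k) - ln X| <= e by rewrite distrC.
have [_ lo] := exp_close _ _ _ cdk0 X0 e2 lnd'.
have dM : qd'%:R <= 4 * M%:R :> R by rewrite -natrM ler_nat ltnW.
have MR' : M%:R <= qd'%:R :> R by rewrite ler_nat.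
exists (v * qa')%N, qb', (2 ^ k * qc')%N, qd'; split.
- rewrite (leq_trans M0) //=; apply: (leq_trans b2); apply: leq_mul => //.
  by apply: leq_trans vL1; apply: leq_trans L256.
- rewrite (leq_trans M0) //= -(ltr_nat R) natrM natrX.
  have h : 32 * (M%:R * M%:R) <= (2 ^+ k * qc'%:R) * qd'%:R :> R by move: lo XL LMM MM; lra.
  rewrite ltNge; apply/negP => h2.
  have h3 : 2 ^+ k * qc'%:R * qd'%:R <= (4 * M%:R) * (4 * M%:R) :> R.
    by apply: (ler_pM _ _ (le_trans h2 dM) dM); rewrite ?mulr_ge0 ?exprn_ge0.
  by lra.
- apply: (@le_trans _ _ ((2 * L * (2 * M))%:R)); first by rewrite ler_nat leq_mul // ltnW.
  by rewrite !natrM; have := mulr_gt0 LR MR; lra.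
- rewrite natrM natrX -(ler_pM2r MR).
  apply: (@le_trans _ _ (2 ^+ k * qc'%:R * qd'%:R)).
    by rewrite ler_wpM2l // mulr_ge0 // ltW.
  by rewrite natrM; move: up XU; lra.
rewrite natrM [(v * qa')%:R]natrM.
have -> : al * (v%:R * qa'%:R * qb'%:R) - (2 ^ k * qc' * qd')%:R = X - qc'%:R * qd'%:R * 2 ^+ k.
  by rewrite /X !natrM natrX; ring.
apply: (le_trans diff).
apply: (@le_trans _ _ (2 * e * (16 * (L%:R * M%:R * M%:R)))); first by rewrite ler_wpM2l // mulr_ge0.
rewrite ler_pdivlMr ?exprn_gt0 //.
have -> : 2 * e * (16 * (L%:R * M%:R * M%:R)) * M%:R ^+ 2 = 32 * (e * M%:R ^+ 4) * L%:R by ring.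
rewrite ler_piMl ?(ltW LR) //; move: eM; lra.
Qed.
End Solution.

(* With [rho = 2 ^ n], the base is [b = rho ^ s]; the box has side [M = b ^ m / rho] and the
   multipliers range over [L = b ^ r].  The losses of the second moment are powers of [rho],
   while [s] is so large that [K] square roots of [1 / b] still save [rho ^ 8]. *)
Section Params.
Variables (p n : nat).
Definition prmK := (4 * p)%N.
Definition prmm := (p * p)%N.
Definition prms := (8 * 2 ^ prmK + 1)%N.
Definition prmr := (p + (2 * prmK + 5))%N.
Definition prmb := (2 ^ (n * prms))%N.
Definition prmmu := (n * (prms * prmm - 1))%N.
Definition prmJ := (prmb ^ (4 * prmm + prmr + 1))%N.
End Params.

Section BadFraction.
Context {R : realType}.

Lemma tau_max E N C : (0 < E)%N -> (forall n, (0 < n)%N -> (tau n ^ E <= C * n)%N) ->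
  exists D, (forall n, (0 < n <= N)%N -> (tau n <= D)%N) /\ (D ^ E <= C * N)%N.
Proof.
move=> E0 hC; exists (\max_(i < N) tau i.+1); split.
  move=> [//|n] /= nN; exact: (@leq_bigmax _ (fun i : 'I_N => tau i.+1) (Ordinal nN)).
elim/big_ind: _ => [|x y hx hy|i _].
- by rewrite exp0n.
- by rewrite /maxn; case: ifP.
by apply: (leq_trans (hC _ _)); rewrite // leq_mul2l ltn_ord orbT.
Qed.

(** In powers of [rho], the factors [th^2 = rho^-16], [rho^4] and [D^4], the last being a constant
    times [rho], leave [rho^-11], of which [rho^-1 = 2^-n] is kept. The condition on [p] gives
    [8 p + 5 <= p^2], which makes [M] a multiple of [4 b^(g.-1)], as the density at the coarse scale
    demands. *)
Lemma bad_fraction p : (9 <= p)%N -> exists (C : R) (n0 : nat), forall n, (n0 <= n)%N ->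
  [/\ (8 <= 2 ^ n)%N, (4 ^ (prmK p).+2 <= prmb p n)%N,
      (prmb p n ^ prmm p = 2 ^ n * 2 ^ prmmu p n)%N &
  #|[pred x | @weight R p (prmK p) (prmm p) (prmb p n) (prmmu p n) x <= 0]|%:R
    <= (prmJ p n)%:R * (C / 2 ^+ n)].
Proof.
move=> p9; set K := prmK p; set m := prmm p; set s := prms p.
have p0 : (0 < p)%N by exact: leq_trans p9.
have m1 : (8 * p + 5 <= m)%N by rewrite /m /prmm; nia.
have s0 : (0 < s)%N by rewrite /s /prms addn1.
have s9 : (9 <= s)%N by rewrite /s /prms; have := expn_gt0 2 (prmK p); lia.
(* With this exponent [D^4] is at most a constant times [M^(1 / (s m))], hence a constant times
   [rho]. *)
pose E := (16 * (s * m))%N.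
have E0 : (0 < E)%N by rewrite !muln_gt0 s0 /=; lia.
have [C hC] := tau_bound E E0.
pose C1 := ((C + 1) * 2 ^ 11)%N.
exists (48 * (72 * m%:R) ^+ 2 * C1%:R), (band_const K + 3)%N => n nn0.
have n3 : (3 <= n)%N by lia.
have n1 : (1 <= n)%N by lia.
set b := prmb p n.
have b4 : (4 ^ K.+2 <= b)%N.
  rewrite -[4%N]/(2 ^ 2)%N -expnM /b /prmb leq_exp2l // -/s.
  apply: (@leq_trans s); last by rewrite leq_pmull.
  have : (K < 2 ^ K)%N by rewrite ltn_expl.
  by rewrite /s /prms -/K; lia.
have rho8 : (8 <= 2 ^ n)%N by rewrite -[8%N]/(2 ^ 3)%N leq_exp2l.
have sm1 : (1 <= s * m)%N by rewrite muln_gt0 s0 /=; lia.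
have bM : (b ^ m = 2 ^ n * 2 ^ prmmu p n)%N.
  rewrite /b /prmb -expnM -expnD; congr (2 ^ _)%N; rewrite /prmmu -/s -/m.
  by rewrite mulnBr muln1 subnKC ?leq_pmulr // mulnA.
split=> //.
have [|D [hD DE]] := tau_max E (2 ^ 11 * (2 ^ prmmu p n) ^ 4) C E0; first exact: hC.
pose rho : R := 2 ^+ n.
have rho1 : 1 <= rho by rewrite exprn_ege1 // ler1n.
have rho0 : 0 < rho by lra.
pose th : R := (rho ^+ 8)^-1.
have th0 : 0 < th by rewrite invr_gt0 exprn_gt0.
have th1 : th <= 1 by rewrite invf_le1 ?exprn_gt0 // exprn_ege1.
have bR : b%:R = rho ^+ s :> R by rewrite /b /prmb natrX exprM.
have D4 : (D ^ 4 <= C1 * 2 ^ n)%N.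
  have e0 : (0 < 4 * (s * m))%N by move: sm1; lia.
  rewrite -(leq_exp2r _ _ e0).
  rewrite -expnM mulnA -/E; apply: (leq_trans DE).
  rewrite expnMn mulnA; apply: leq_mul.
    apply: (@leq_trans C1); first by rewrite /C1 leq_mul2r leq_addr orbT.
    by rewrite -{1}(expn1 C1) leq_pexp2l // ?muln_gt0 ?addn1 //= muln_gt0.
  rewrite -!expnM leq_exp2l // /prmmu -/s -/m -mulnA leq_mul2l; apply/orP; right.
  by rewrite mulnC leq_mul2l /= leq_subr.
have sE : s = (8 * 2 ^ K).+1 by rewrite /s /prms addn1.
(* Here [b] is [rho] times [(rho^8)^(2^K)], and the spare factor [rho] exceeds [band_const K]. *)
have hth : (band_const K)%:R / b%:R <= th ^+ (2 ^ K).
  rewrite bR sE exprS exprM invfM mulrA /th exprVn.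
  rewrite -[leRHS]mul1r ler_wpM2r ?invr_ge0 ?exprn_ge0 ?(ltW rho0) //.
  rewrite ler_pdivrMr // mul1r /rho -natrX ler_nat ltnW //.
  by apply: (@leq_ltn_trans n); [lia | exact: ltn_expl].
have M0 : (0 < 2 ^ prmmu p n)%N by rewrite expn_gt0.
pose n1' := (2 ^ (prmmu p n - n * s * (8 * p + 4) - 2))%N.
have exps : (n * s * (8 * p + 4) + 2 <= prmmu p n)%N.
  rewrite /prmmu -/s -/m -mulnA; apply: (@leq_trans (n * (s * (8 * p + 5) - 1))).
    apply: (@leq_trans (n * (s * (8 * p + 4) + 2))); first by rewrite [leqRHS]mulnDr leq_add2l leq_pmull.
    by rewrite leq_mul2l; apply/orP; right; rewrite (_ : 8 * p + 5 = (8 * p + 4).+1)%N ?mulnS; lia.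
  by rewrite leq_mul2l leq_sub2r ?orbT // leq_mul2l m1 orbT.
have Kb : (K <= b)%N.
  apply: leq_trans b4; apply: (@leq_trans (4 ^ K)); first by rewrite ltnW // ltn_expl.
  by rewrite leq_exp2l //; lia.
have mK : ((4 * m) %/ p <= K)%N by rewrite /m /prmm mulnA mulnK // /K /prmK.
have Mn1 : (2 ^ prmmu p n = 4 * n1' * b ^ (2 * K + 5).-1)%N.
  have -> : (2 * K + 5).-1 = (8 * p + 4)%N by rewrite addnS /= /K /prmK; lia.
  rewrite /n1' /b /prmb -expnM -[4%N]/(2 ^ 2)%N -!expnD; congr (2 ^ _)%N.
  by rewrite -/s; move: exps; lia.
have gm : ((2 * K + 5).-1 <= 4 * m)%N by rewrite addnS /= /K /prmK; lia.
have th01 : 0 <= th <= 1 by rewrite (ltW th0).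
have h := @bad_count R p K m b (2 ^ n) (prmmu p n) n1' D th p0 b4 Kb mK bM rho8 Mn1 gm hD th01 hth.
apply: (le_trans h); rewrite ler_wpM2l // /prmJ -/b natrX -/rho.
have D4R : D%:R ^+ 4 <= C1%:R * rho by rewrite /rho -!natrX -natrM ler_nat.
have A0 : 0 <= 48 * (72 * m%:R) ^+ 2 :> R by rewrite mulr_ge0 ?sqr_ge0.
have -> : 48 * (72 * m%:R) ^+ 2 * th ^+ 2 * D%:R ^+ 4 * rho ^+ 4 =
   48 * (72 * m%:R) ^+ 2 * (th ^+ 2 * rho ^+ 4 * D%:R ^+ 4) by ring.
rewrite -[leRHS]mulrA; apply: ler_wpM2l => //.
have t0 : 0 <= th ^+ 2 * rho ^+ 4 by rewrite mulr_ge0 ?exprn_ge0 ?(ltW th0) ?(ltW rho0).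
apply: (@le_trans _ _ (th ^+ 2 * rho ^+ 4 * (C1%:R * rho))); first by rewrite ler_wpM2l.
have -> : th ^+ 2 * rho ^+ 4 * (C1%:R * rho) = C1%:R * (rho ^+ 11)^-1.
  by rewrite /th; field; rewrite lt0r_neq0.
rewrite ler_wpM2l // lef_pV2 ?posrE ?exprn_gt0 //.
by rewrite -{1}(expr1 rho) ler_weXn2l.
Qed.
End BadFraction.

(** * Null sets *)

Section NullSets.
Context {R : realType}.
Local Notation mu := (@lebesgue_measure R).

Lemma measure_bigsetU_le (I : Type) (s : seq I) (P : pred I) (F : I -> set R) (e : R) :
  0 <= e -> (forall i, measurable (F i)) -> (forall i, (mu (F i) <= e%:E)%E) ->
  measurable (\big[setU/set0]_(i <- s | P i) F i) /\
  (mu (\big[setU/set0]_(i <- s | P i) F i) <= ((count P s)%:R * e)%:E)%E.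
Proof.
move=> e0 mF Fe; elim: s => [|i s [mS IH]].
  by rewrite big_nil measure0 mul0r.
rewrite big_cons /=; case: (P i) => /=; last by rewrite add0n.
split; first exact: measurableU.
have h := measureU2 (mu : {measure set _ -> \bar R}) (mF i) mS. apply: (le_trans h).
by rewrite natrD mulrDl mul1r EFinD; apply: leeD; [exact: Fe|exact: IH].
Qed.

Lemma borel_cantelli_geometric (F : nat -> set R) (A : R) : 0 <= A ->
  (forall n, measurable (F n)) -> (forall n, (mu (F n) <= (A / 2 ^+ n)%:E)%E) ->
  mu (lim_sup_set F) = 0%E.
Proof.
move=> A0 mF hF; apply: lim_sup_set_cvg0 => //.
apply: (@le_lt_trans _ _ (\sum_(n <oo) ((A * 2) / (2 ^ n.+1)%:R)%:E)%E).
  apply: lee_nneseries => n _ //.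
  by rewrite natrX exprS invfM mulrA mulfK // hF.
by rewrite (le_lt_trans (epsilon_trick0 _ _)) ?ltry // mulr_ge0.
Qed.

(** The set of [al] whose value [J log2 (al / c)] lies between [x] and [x + 1]; one cell of the
    circle pulled back to the line. *)
Definition arc (c : R) (J x : nat) : set R :=
  [set` `[c * expR (x%:R * (ln 2 / J%:R)), c * expR (x.+1%:R * (ln 2 / J%:R))]].

Lemma measurable_arc c J x : measurable (arc c J x).
Proof. exact: measurable_itv. Qed.

Lemma measure_arc c J x : 0 < c -> (1 < J)%N -> (x < J)%N ->
  (mu (arc c J x) <= (4 * c / J%:R)%:E)%E.
Proof.
move=> c0 J1 xJ; have l2 := @ln2_gt0 R; have l1 := @ln2_le1 R.
have J2 : 2 <= J%:R :> R by rewrite ler_nat.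
have JR : 0 < J%:R :> R by lra.
rewrite /arc lebesgue_measure_itv /=; case: ifP => _; last by rewrite lee_fin divr_ge0 // mulr_ge0 // ltW.
rewrite -EFinB lee_fin -mulrBr.
set t := ln 2 / J%:R.
have t0 : 0 < t by rewrite divr_gt0.
have tJ : t <= J%:R^-1 by rewrite ler_piMl // invr_ge0 ltW.
have iJ : J%:R^-1 <= 2^-1 :> R by rewrite lef_pV2 ?posrE.
have e1 : expR (x%:R * t) <= 2.
  rewrite -[leRHS](lnK (_ : 2 \is Num.pos)) ?posrE // ler_expR /t mulrA ler_pdivrMr // mulrC.
  by rewrite ler_wpM2l ?ler_nat ?(ltnW xJ) ?(ltW l2).
have e2 : expR t - 1 <= 2 * t.
  have := expR_ge1Dx (- t); rewrite expRN => h.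
  have E0 := expR_gt0 t.
  have h2 : (1 - t) * expR t <= 1 by rewrite -ler_pdivlMr // div1r.
  nra.
rewrite -[x.+1]addn1 natrD mulrDl mul1r expRD.
have -> : expR (x%:R * t) * expR t - expR (x%:R * t) = expR (x%:R * t) * (expR t - 1) by ring.
have -> : 4 * c / J%:R = c * (2 * (2 * J%:R^-1)) by ring.
rewrite ler_wpM2l ?(ltW c0) //.
have e3 : 0 <= expR t - 1 by have := expR_ge1Dx t; lra.
apply: ler_pM; [exact: expR_ge0|exact: e3|exact: e1|].
by apply: (le_trans e2); rewrite ler_wpM2l.
Qed.

Definition good_scale p (al : R) n : Prop :=
  approx_sol al (32 * (prmb p n ^ prmr p * 2 ^ prmmu p n)%:R)
    ((prmb p n ^ prmr p)%:R / (2 ^ prmmu p n)%:R ^+ 2).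

Lemma ae_good_scale p c : (9 <= p)%N -> 0 < c ->
  {ae mu, forall al, c <= al < 2 * c ->
    exists n0, forall n, (n0 <= n)%N -> good_scale p (al / c) n}.
Proof.
move=> p9 c0; have [C0 [n0 hn0]] := @bad_fraction R p p9.
pose C := `|C0|.
pose wt n := @weight R p (prmK p) (prmm p) (prmb p n) (prmmu p n).
pose B n : set R := \big[setU/set0]_(z : 'Z_(prmJ p n) | wt n z <= 0) arc c (prmJ p n) (val z).
(* Below [n0] there is no estimate; empty sets keep the geometric bound valid for every [n]. *)
pose F n := if (n0 <= n)%N then B n else set0.
have Jn n : (n0 <= n)%N -> (1 < prmJ p n)%N.
  move=> /hn0[_ b4 _ _]; rewrite /prmJ -[1%N](expn0 (prmb p n)) ltn_exp2l ?addn1 //.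
  by apply: leq_trans b4; rewrite -[2%N]/(4 ^ 0 + 1)%N addn1 ltn_exp2l.
have A0 : 0 <= 4 * c * C by rewrite !mulr_ge0 ?normr_ge0 ?(ltW c0).
have FB n : measurable (F n) /\ (mu (F n) <= ((4 * c * C) / 2 ^+ n)%:E)%E.
  rewrite /F; case: ifP => nn; last first.
    by rewrite measure0; split => //; rewrite lee_fin divr_ge0 // exprn_ge0.
  have J1 := Jn n nn.
  have JR : 0 < (prmJ p n)%:R :> R by rewrite ltr0n ltnW.
  have e0 : 0 <= 4 * c / (prmJ p n)%:R by rewrite divr_ge0 ?mulr_ge0 ?(ltW c0).
  have zJ (z : 'Z_(prmJ p n)) : (val z < prmJ p n)%N.
    by rewrite -[X in (_ < X)%N](Zp_cast J1) ltn_ord.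
  have [mB muB] := @measure_bigsetU_le _ (index_enum 'Z_(prmJ p n)) (fun z => wt n z <= 0)
    (fun z => arc c (prmJ p n) (val z)) _ e0 (fun z => measurable_arc c _ _)
    (fun z => measure_arc c _ _ c0 J1 (zJ z)).
  split=> //; apply: (le_trans muB); rewrite lee_fin.
  have [_ _ _ hbad] := hn0 n nn.
  have cnt : (count (fun z => wt n z <= 0) (index_enum 'Z_(prmJ p n)))%:R <= (prmJ p n)%:R * (C / 2 ^+ n).
    apply: (@le_trans _ _ ((prmJ p n)%:R * (C0 / 2 ^+ n))); last first.
      by rewrite ler_wpM2l ?(ltW JR) // ler_wpM2r ?invr_ge0 ?exprn_ge0 // ler_norm.
    by apply: le_trans hbad; rewrite -sum1_count -sum1_card.
  apply: (le_trans (ler_wpM2r e0 cnt)).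
  by rewrite le_eqVlt; apply/orP; left; apply/eqP; field; rewrite ?(lt0r_neq0 JR) ?expf_neq0 ?pnatr_eq0.
have null : mu.-negligible (lim_sup_set F).
  exists (lim_sup_set F); split=> //.
  - by apply: bigcapT_measurable => k; apply: bigcup_measurable => j _; exact: (FB j).1.
  - by apply: (borel_cantelli_geometric F (4 * c * C)) => // n; have [] := FB n.
apply: negligibleS null => al /= hal.
apply: contrapT => nlim; apply: hal => /andP[al1 al2].
have [N hN] : exists N, forall n, (N <= n)%N -> ~ F n al.
  apply: contrapT => hN; apply: nlim => N _.
  apply: contrapT => h; apply: hN; exists N => n Nn Fn.
  by apply: h; exists n.
exists (maxn N n0) => n; rewrite geq_max => /andP[Nn n0n].
have [rho8 b4 bM _] := hn0 n n0n.
apply: (@weight_sol R p (prmK p) (prmm p) (prmb p n) (2 ^ n) (prmmu p n) b4 bM rho8).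
  by rewrite ler_pdivlMr // mul1r al1 ltr_pdivrMr.
rewrite ltNge; apply/negP => wt0; apply: (hN n Nn); rewrite /F n0n /B.
set x := cell _ _ _ _ _ in wt0.
have J1 := Jn n n0n.
have JR : 0 < (prmJ p n)%:R :> R by rewrite ltr0n ltnW.
have l2 := @ln2_gt0 R.
have ac1 : 1 <= al / c by rewrite ler_pdivlMr // mul1r.
have ac2 : al / c < 2 by rewrite ltr_pdivrMr.
have ac0 : 0 < al / c by lra.
have x0 : 0 <= (prmJ p n)%:R / ln 2 * ln (al / c).
  by rewrite mulr_ge0 ?ln_ge0 // divr_ge0 // ltW.
have /andP[x1 x2] := truncn_itv x0.
have xJ : (x < prmJ p n)%N.
  rewrite -(ltr_nat R); apply: (le_lt_trans x1).
  by rewrite -mulrA gtr_pMr // ltr_pdivrMl // mulr1 ltr_ln ?posrE.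
have vx : val (x%:R : 'Z_(prmJ p n)) = x by rewrite /= val_Zp_nat // modn_small.
rewrite (bigD1 (x%:R : 'Z_(prmJ p n))) //=; left; rewrite -/(val _) vx /arc /= in_itv /=.
have alE : al = c * expR (ln (al / c)) by rewrite lnK ?posrE // mulrC divfK // lt0r_neq0.
have jl : 0 < ln (2 : R) / (prmJ p n)%:R by rewrite divr_gt0.
have lnE : ln (al / c) = (prmJ p n)%:R / ln 2 * ln (al / c) * (ln 2 / (prmJ p n)%:R).
  by field; rewrite !lt0r_neq0.
rewrite {1 2}alE !ler_pM2l // !ler_expR lnE !ler_pM2r //.
by apply/andP; split; [exact: x1 | exact: ltW].
Qed.

End NullSets.

(** * The spectrum and its gaps *)

Section Spectrum.
Context {R : realType}.
Variable al : R.
Hypothesis al0 : 0 < al.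

Definition spec_list (A B : nat) : seq R :=
  [seq al * m%:R ^+ 2 + n%:R ^+ 2 | m <- iota 1 A, n <- iota 1 B].

Lemma spec_list_mem (x k : R) : spec_set al x -> x <= al * k ^+ 2 -> x <= k ^+ 2 -> 0 <= k ->
  x \in spec_list (Num.truncn k) (Num.truncn k).
Proof.
move=> [m [n [m0 n0 ->]]] h1 h2 k0.
have mR : 0 <= m%:R ^+ 2 :> R by exact: sqr_ge0.
have nR : 0 <= n%:R ^+ 2 :> R by exact: sqr_ge0.
apply/allpairsP; exists (m, n); rewrite /= !mem_iota m0 n0 !add1n !ltnS; split=> //.
  rewrite truncn_ge_nat // -(@ler_pXn2r _ 2) ?nnegrE //.
  by rewrite -(ler_pM2l al0); lra.
rewrite truncn_ge_nat // -(@ler_pXn2r _ 2) ?nnegrE //.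
have := mulr_ge0 (ltW al0) mR; lra.
Qed.

Lemma spec_list_spec A B x : x \in spec_list A B -> spec_set al x.
Proof.
move=> /allpairsP[[m n] /= [mA nB ->]]; exists m, n; split=> //.
  by move: mA; rewrite mem_iota => /andP[].
by move: nB; rewrite mem_iota => /andP[].
Qed.

(** Chosen so that [al m^2 + n^2 <= (al + 1) Y^2] forces both [m] and [n] to be at most
    [kap * Y]. *)
Definition kap : R := al + 1 + (al + 1) / al.

Lemma kap_ge : [/\ 1 <= kap, (al + 1) <= al * kap & al + 1 <= kap].
Proof.
have h : 1 <= (al + 1) / al by rewrite ler_pdivlMr // mul1r lerDl.
have e : al * ((al + 1) / al) = al + 1 by rewrite mulrC divfK ?lt0r_neq0.
have := mulr_gt0 al0 al0; rewrite /kap mulrDr e; move: h; move: (_ / al) => z h aa.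
by split; move: al0 h aa; lra.
Qed.

Lemma spec_pos x : spec_set al x -> 0 < x.
Proof.
move=> [m [n [m0 n0 ->]]]; rewrite addr_gt0 //; last by rewrite exprn_gt0 // ltr0n.
by rewrite mulr_gt0 // exprn_gt0 // ltr0n.
Qed.

Lemma spec_bounded (x : R) : exists A, forall y, spec_set al y -> y <= x -> y \in spec_list A A.
Proof.
pose z := Num.max x 1.
have z1 : 1 <= z by rewrite le_max lexx orbT.
have [k1 k2 k3] := kap_ge.
have k0 : 0 < kap by lra.
exists (Num.truncn (kap * z)) => y Sy yx.
have yz : y <= z by rewrite (le_trans yx) // le_max lexx.
have z2 : z <= z ^+ 2 by rewrite expr2 ler_peMr //; lra.
have kk : kap <= kap ^+ 2 by rewrite expr2 ler_peMr // ltW.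
have z0 : 0 <= z ^+ 2 by exact: sqr_ge0.
apply: spec_list_mem => //; last by rewrite mulr_ge0 //; lra.
  apply: (le_trans yz); apply: (le_trans z2); rewrite exprMn mulrA ler_peMl //.
  apply: (@le_trans _ _ (al * kap)); first by move: k2 al0; lra.
  by rewrite ler_wpM2l ?(ltW al0).
by apply: (le_trans yz); apply: (le_trans z2); rewrite exprMn ler_peMl // (le_trans k1).
Qed.

Lemma spec_unbounded (y : R) : exists2 x, spec_set al x & y < x.
Proof.
have y0 : 0 <= Num.max y 0 by rewrite le_max lexx orbT.
pose n := (Num.truncn (Num.max y 0)).+1.
exists (al * 1%:R ^+ 2 + n%:R ^+ 2); first by exists 1%N, n.
have h : y < n%:R.
  have /andP[_] := truncn_itv y0; apply: le_lt_trans; by rewrite le_max lexx.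
have n1 : 1 <= n%:R :> R by rewrite ler1n.
have n2 : n%:R <= n%:R ^+ 2 :> R by rewrite expr2 ler_peMr.
by rewrite expr1n mulr1; move: al0; lra.
Qed.

Lemma seq_min (s : seq R) : s != [::] -> exists2 z, z \in s & forall t, t \in s -> z <= t.
Proof.
elim: s => // x s IH _; have [->|/IH[z zs hz]] := eqVneq s [::].
  by exists x; rewrite ?mem_seq1 // => t; rewrite mem_seq1 => /eqP ->.
case/orP: (le_total x z) => xz.
  exists x; rewrite ?mem_head // => t; rewrite inE => /predU1P[->//|/hz].
  exact: le_trans.
exists z; rewrite ?inE ?zs ?orbT // => t /predU1P[->//|/hz//].
Qed.

Lemma spec_next (y : R) : exists z, [/\ spec_set al z, y < z &
  forall x, spec_set al x -> y < x -> z <= x].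
Proof.
have [x Sx yx] := spec_unbounded y.
have [A hA] := spec_bounded x.
pose s := [seq t <- spec_list A A | y < t].
have xs : x \in s by rewrite mem_filter yx hA.
have sn : s != [::] by apply: contraTneq xs => ->.
have [z zs hz] := seq_min s sn.
move: zs; rewrite mem_filter => /andP[yz zA].
exists z; split=> //; first exact: spec_list_spec zA.
move=> t St yt; case/orP: (le_total x t) => xt; last first.
  by apply: hz; rewrite mem_filter yt hA.
by apply: le_trans xt; exact: hz.
Qed.

Lemma incr_lt (lam : nat -> R) : (forall i, lam i < lam i.+1) ->
  {mono lam : i j / (i < j)%N >-> i < j}.
Proof.
move=> h; have lt i j : (i < j)%N -> lam i < lam j.
  elim: j => // j IH; rewrite ltnS leq_eqVlt => /predU1P[->|/IH/lt_trans]; first exact: h.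
  exact.
move=> i j; have [/lt//|ji] := ltnP i j.
move: ji; rewrite leq_eqVlt => /predU1P[->|/lt ji]; first by rewrite ltxx.
by apply/negbTE; rewrite -leNgt ltW.
Qed.

Lemma incr_count (lam : nat -> R) A i : (forall i, lam i < lam i.+1) ->
  (forall j, (j <= i)%N -> lam j \in spec_list A A) -> (i < A * A)%N.
Proof.
move=> h hA; have m := incr_lt lam h.
have : (size [seq lam j | j <- iota 0 i.+1] <= size (spec_list A A))%N.
  apply: uniq_leq_size.
    rewrite map_inj_in_uniq ?iota_uniq // => j k _ _ e.
    have [jk|kj|//] := ltngtP j k; [move: jk|move: kj]; by rewrite -m e ltxx.
  move=> x /mapP[j]; rewrite mem_iota add0n => /andP[_ ji] ->; exact: hA.
by rewrite size_map size_iota size_allpairs !size_iota.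
Qed.

(** Iterates the successor given by [spec_next]. A value that is missed would lie above infinitely
    many values, against local finiteness. *)
Lemma exists_enum : exists lam, increasing_enum al lam.
Proof.
have [nx hnx] := choice spec_next.
pose lam := fix f i := if i is j.+1 then nx (f j) else nx 0.
have inc i : lam i < lam i.+1 by have [] := hnx (lam i).
have lamS i : spec_set al (lam i).
  by case: i => [|i]; [have [] := hnx 0 | have [] := hnx (lam i)].
exists lam; split=> //; apply/seteqP; split=> [x [i _ <-]//|x Sx].
apply: contrapT => nx'.
have below i : lam i < x.
  have ne j : lam j != x by apply/eqP => e; apply: nx'; exists j.
  elim: i => [|i IH]; rewrite lt_neqAle ne /=.
    by have [_ _] := hnx 0; apply => //; exact: spec_pos.
  by have [_ _] := hnx (lam i); apply.
have [A hA] := spec_bounded x.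
have := incr_count lam A (A * A) inc (fun j _ => hA _ (lamS j) (ltW (below j))).
by rewrite ltnn.
Qed.

Lemma delta_min_le (lam : nat -> R) N i j : increasing_enum al lam ->
  (i < j < N)%N -> delta_min lam N <= lam j - lam i.
Proof.
move=> [inc _] /andP[ij jN]; have m := incr_lt lam inc.
have iN : (i < N.-1)%N by lia.
apply: (@le_trans _ _ (lam i.+1 - lam i)).
  exact: (@bigmin_le _ _ _ _ (Ordinal iN) (fun j : 'I_N.-1 => lam j.+1 - lam j)).
rewrite lerD2r leNgt m -leqNgt; exact: ij.
Qed.

Lemma delta_min_le0 (lam : nat -> R) N : delta_min lam N <= lam 1%N - lam 0%N.
Proof. exact: bigmin_le_id. Qed.

(** The solution produces two values at distance at most [4 E], distinct because [al] is irrational.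
    All values up to them come from a box with at most [N] points, so both have index below [N], and
    some consecutive gap is no larger than their distance. *)
Lemma approx_sol_gap (lam : nat -> R) X E N : increasing_enum al lam -> irrational al ->
  approx_sol al X E -> (2 * kap * X) ^+ 2 <= N%:R -> delta_min lam N <= 4 * E.
Proof.
move=> enum irr [a [b [c [d [/andP[b0 ba] /andP[d0 dc] aX cX hE]]]]] hN.
have [inc rg] := enum.
have [k1 k2 k3] := kap_ge.
pose x1 := al * (a + b)%:R ^+ 2 + (c - d)%:R ^+ 2.
pose x2 := al * (a - b)%:R ^+ 2 + (c + d)%:R ^+ 2.
have diff : x1 - x2 = 4 * (al * (a * b)%:R - (c * d)%:R).
  by rewrite /x1 /x2 !natrB ?(ltnW ba) ?(ltnW dc) // !natrD !natrM; ring.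
have S1 : spec_set al x1 by exists (a + b)%N, (c - d)%N; split; rewrite // ?addn_gt0 ?b0 ?orbT ?subn_gt0.
have S2 : spec_set al x2 by exists (a - b)%N, (c + d)%N; split; rewrite // ?addn_gt0 ?d0 ?orbT ?subn_gt0.
have X1 : 1 <= X by apply: le_trans aX; rewrite ler1n (leq_ltn_trans _ ba).
pose Y := 2 * X.
have sq2 (u v : nat) : (u <= 2 * v)%N -> v%:R <= X -> u%:R ^+ 2 <= Y ^+ 2.
  move=> uv vX; rewrite lerXn2r ?nnegrE //; first by rewrite /Y; lra.
  apply: (@le_trans _ _ (2 * v)%:R); first by rewrite ler_nat.
  by rewrite natrM /Y; lra.
have bound u v : u%:R ^+ 2 <= Y ^+ 2 -> v%:R ^+ 2 <= Y ^+ 2 ->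
   al * u%:R ^+ 2 + v%:R ^+ 2 <= (al + 1) * Y ^+ 2.
  by move=> h1 h2; rewrite mulrDl mul1r lerD // ler_wpM2l // ltW.
have [ab2 ab2'] : (a + b <= 2 * a)%N /\ (a - b <= 2 * a)%N.
  by move: ba; clear; split; lia.
have [cd2 cd2'] : (c + d <= 2 * c)%N /\ (c - d <= 2 * c)%N.
  by move: dc; clear; split; lia.
have x1Y : x1 <= (al + 1) * Y ^+ 2.
  by apply: bound; [exact: (sq2 _ _ ab2) | exact: (sq2 _ _ cd2')].
have x2Y : x2 <= (al + 1) * Y ^+ 2.
  by apply: bound; [exact: (sq2 _ _ ab2') | exact: (sq2 _ _ cd2)].
have inN x i : x = lam i -> x <= (al + 1) * Y ^+ 2 -> (i < N)%N.
  move=> xi xY.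
  have Y0 : 0 <= Y ^+ 2 by exact: sqr_ge0.
  have kk : kap <= kap ^+ 2 by rewrite expr2 ler_peMr //; lra.
  have kY : 0 <= kap * Y by rewrite mulr_ge0 /Y //; lra.
  pose A := Num.truncn (kap * Y).
  have AN : (A * A <= N)%N.
    rewrite -(ler_nat R) natrM -expr2; apply: le_trans hN.
    rewrite lerXn2r ?nnegrE // /Y; first by rewrite !mulr_ge0 //; lra.
    have -> : 2 * kap * X = kap * Y by rewrite /Y; ring.
    by rewrite truncn_le.
  apply: leq_trans AN; apply: (incr_count lam A i inc) => j ji.
  have jx : lam j <= x by rewrite xi leNgt (incr_lt lam inc) -leqNgt.
  have jS : spec_set al (lam j) by rewrite -rg; exists j.
  apply: spec_list_mem => //.
    apply: (le_trans jx); apply: (le_trans xY); have -> : al * (kap * Y) ^+ 2 = al * kap ^+ 2 * Y ^+ 2 by ring.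
    apply: (ler_wpM2r Y0).
    by apply: (le_trans k2); rewrite ler_wpM2l ?(ltW al0).
  apply: (le_trans jx); apply: (le_trans xY); have -> : (kap * Y) ^+ 2 = kap ^+ 2 * Y ^+ 2 by ring.
  apply: (ler_wpM2r Y0).
  by apply: le_trans kk.
have [i _ li] : range lam x1 by rewrite rg.
have [j _ lj] : range lam x2 by rewrite rg.
have iN := inN _ _ (esym li) x1Y; have jN := inN _ _ (esym lj) x2Y.
have d4 : `|x1 - x2| <= 4 * E by rewrite diff normrM gtr0_norm // ler_wpM2l.
have [ij|ji|e] := ltngtP i j.
- apply: (le_trans (delta_min_le lam N i j enum _)); first by rewrite ij.
  by rewrite li lj; apply: le_trans d4; rewrite distrC ler_norm.
- apply: (le_trans (delta_min_le lam N j i enum _)); first by rewrite ji.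
  by rewrite li lj; apply: le_trans d4; rewrite ler_norm.
have e12 : x1 = x2 by rewrite -li -lj e.
exfalso; move: diff; rewrite e12 subrr => /esym/eqP.
rewrite mulf_eq0 pnatr_eq0 /= subr_eq0 => /eqP hab.
apply: irr.
apply/rationalP; exists (c * d)%N%:Z, (a * b)%N.
rewrite -pmulrn -hab mulfK // pnatr_eq0 -lt0n muln_gt0 b0 andbT; exact: ltn_trans ba.
Qed.

End Spectrum.

(** * Reduction to one octave and interpolation in [N] *)

Section Final.
Context {R : realType}.
Local Notation mu := (@lebesgue_measure R).

Lemma ae_forall_nat (P : nat -> R -> Prop) :
  (forall n, {ae mu, forall x, P n x}) -> {ae mu, forall x, forall n, P n x}.
Proof.
move=> h; apply: negligibleS (negligible_bigcup h) => x /= nP.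
apply: contrapT => nb; apply: nP => n; apply: contrapT => nPn; apply: nb.
by exists n.
Qed.

Lemma ae_impl (P Q : R -> Prop) : (forall x, P x -> Q x) ->
  {ae mu, forall x, P x} -> {ae mu, forall x, Q x}.
Proof.
by move=> PQ; apply: negligibleS => x /= nQ Px; apply: nQ; exact: PQ.
Qed.

Definition dyadic (s : bool) k : R := if s then 2 ^+ k else (2 ^+ k)^-1.

Lemma dyadic_gt0 s k : 0 < dyadic s k.
Proof. by rewrite /dyadic; case: s; rewrite ?invr_gt0 exprn_gt0. Qed.

Lemma expr2n_gt n : n%:R < 2 ^+ n :> R.
Proof. by rewrite -natrX ltr_nat ltn_expl. Qed.

Lemma dyadic_cover al : 0 < al -> exists s k, dyadic s k <= al < 2 * dyadic s k.
Proof.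
move=> a0; have [a1|a1] := leP 1 al.
  have ex : exists k, al < 2 ^+ k.
    exists (Num.truncn al).+1; apply: lt_trans (expr2n_gt _).
    by have /andP[] := truncn_itv (ltW a0).
  case: (ex_minnP ex) => -[|k] hk mink; first by move: hk; rewrite expr0 ltNge a1.
  exists true, k; rewrite /dyadic -exprS hk andbT leNgt; apply/negP => /mink.
  by rewrite ltnn.
have ex : exists k, (2 ^+ k)^-1 <= al.
  exists (Num.truncn al^-1).+1; rewrite -[leRHS]invrK lef_pV2 ?posrE ?invr_gt0 ?exprn_gt0 //.
  apply/ltW/(lt_trans _ (expr2n_gt _)).
  have ai : 0 <= al^-1 by rewrite invr_ge0 ltW.
  by have /andP[] := truncn_itv ai.
case: (ex_minnP ex) => -[|k] hk mink; first by move: hk; rewrite expr0 invr1 leNgt a1.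
exists false, k.+1; rewrite /dyadic hk /= exprS invfM mulrA divff ?pnatr_eq0 // mul1r ltNge.
by apply/negP => /mink; rewrite ltnn.
Qed.

(** The power of 2 separating [al] from the base octave is absorbed into [c] or into [a], according
    to its sign; the loss depends on [al] only. *)
Lemma approx_sol_dyadic s k al X E :
  approx_sol (al / dyadic s k) X E -> approx_sol al (2 ^+ k * X) (2 ^+ k * E).
Proof.
move=> [a [b [c [d [/andP[b0 ba] /andP[d0 dc] aX cX hE]]]]].
have k1 : 1 <= 2 ^+ k :> R by rewrite exprn_ege1 // ler1n.
have k0 : 0 < 2 ^+ k :> R by rewrite exprn_gt0.
have X0 : 0 <= X by exact: le_trans aX.
have le x : x <= X -> x <= 2 ^+ k * X by move=> /le_trans; apply; rewrite ler_peMl.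
have pow2 x y : (x < y)%N -> (x < 2 ^ k * y)%N.
  by move=> /leq_trans; apply; rewrite leq_pmull // expn_gt0.
case: s hE => /= hE.
  exists a, b, (2 ^ k * c)%N, d; rewrite b0 ba d0 pow2 //; split=> //; first exact: le.
    by rewrite natrM natrX ler_wpM2l // ltW.
  have -> : al * (a * b)%:R - (2 ^ k * c * d)%:R = 2 ^+ k * (al / 2 ^+ k * (a * b)%:R - (c * d)%:R).
    by rewrite -mulnA (natrM _ (2 ^ k)) natrX; field; rewrite lt0r_neq0.
  by rewrite normrM gtr0_norm // ler_wpM2l // ltW.
exists (2 ^ k * a)%N, b, c, d; rewrite b0 pow2 // d0 dc; split=> //; last 1 first.
- have -> : al * (2 ^ k * a * b)%:R = al / (2 ^+ k)^-1 * (a * b)%:R.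
    by rewrite invrK -mulnA (natrM _ (2 ^ k)) natrX; ring.
  by apply: (le_trans hE); rewrite ler_peMl // (le_trans _ hE).
- by rewrite natrM natrX ler_wpM2l // ltW.
exact: le.
Qed.

(* [27 p + 15 <= 30 p <= 2 e p^2], which is the exponent condition [3 s r <= 2 e (s r + s m - 1)] *)
Lemma exponent_choice p (e r m : R) : (9 <= p)%N -> 15 <= e * p%:R -> 0 < e ->
  r = (prms p * prmr p)%:R -> m = (prms p * prmm p - 1)%:R ->
  r + 2 * (r + m) * (1 - e) <= 2 * m.
Proof.
move=> p9 ep e0 -> ->.
have rE : (prmr p = 9 * p + 5)%N by rewrite /prmr /prmK; lia.
have s1 : (1 <= prms p)%N by rewrite /prms addn1.
have sm1 : (1 <= prms p * prmm p)%N by rewrite muln_gt0 s1 /prmm muln_gt0; lia.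
have -> : (prms p * prmm p - 1)%:R = (prms p)%:R * (p%:R * p%:R) - 1 :> R.
  by rewrite natrB // natrM /prmm natrM.
have -> : (prms p * prmr p)%:R = (prms p)%:R * (9 * p%:R + 5) :> R by rewrite rE natrM natrD natrM.
set s : R := (prms p)%:R; set P : R := p%:R.
have P9 : 9 <= P by rewrite ler_nat.
have s1R : 1 <= s by rewrite ler1n.
have h1 : 15 * P <= e * P * P by rewrite ler_wpM2r //; lra.
have h2 : s * (27 * P + 15) <= s * (2 * (e * P * P)) by rewrite ler_wpM2l; lra.
have h3 : 0 <= e * (s * (9 * P + 5) - 1).
  by rewrite mulr_ge0 ?(ltW e0) // subr_ge0; nra.
lra.
Qed.

(** The scale indexed by [n] serves all [N >= u n]. Consecutive [u n] have a constant ratio, so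
    passing from [u n] to a general [N] costs a constant factor. *)
Lemma delta_min_bound (lam : nat -> R) al (e : R) : 0 < al -> irrational al ->
  increasing_enum al lam -> 0 < e < 1 ->
  (forall p, (9 <= p)%N -> forall s k, dyadic s k <= al < 2 * dyadic s k ->
    exists n0, forall n, (n0 <= n)%N -> good_scale p (al / dyadic s k) n) ->
  exists C, 0 < C /\ forall N, (2 <= N)%N -> delta_min lam N <= C * N%:R `^ (-1 + e).
Proof.
move=> al0 irr enum /andP[e0 e1] good.
pose p := maxn 9 (Num.truncn (15 / e)).+1.
have p9 : (9 <= p)%N by rewrite leq_maxl.
have ep : 15 <= e * p%:R.
  rewrite mulrC -ler_pdivrMr //.
  have ei : 0 <= 15 / e by rewrite divr_ge0 // ltW.
  have /andP[_ /ltW /le_trans] := truncn_itv ei; apply.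
  by rewrite ler_nat leq_maxr.
have expo := exponent_choice p e _ _ p9 ep e0 erefl erefl.
have [sg [k hk]] := dyadic_cover al al0.
have [n0 hn0] := good p p9 sg k hk.
pose r := (prms p * prmr p)%N; pose m := (prms p * prmm p - 1)%N.
pose Q : R := 2 ^+ k.
have Q1 : 1 <= Q by rewrite exprn_ege1 // ler1n.
have [k1 _ _] := kap_ge al al0.
(* The requirement [(2 * kap * X)^2 <= N] of [approx_sol_gap], with [X] equal to
   [Q * 32 * L * M]. *)
pose A0 := (64 * kap al * Q) ^+ 2.
have A1 : 1 <= A0 by rewrite exprn_ege1 //; nra.
have A00 : 0 < A0 by exact: lt_le_trans A1.
pose u n : R := A0 * 2 ^+ (2 * (n * (r + m))).
have step n N : (n0 <= n)%N -> u n <= N%:R -> delta_min lam N <= 4 * (Q * (2 ^+ (n * r) / 2 ^+ (2 * (n * m)))).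
  move=> nn uN; have := hn0 n nn; rewrite /good_scale => /approx_sol_dyadic.
  rewrite natrM.
  have -> : (prmb p n ^ prmr p)%:R = 2 ^+ (n * r) :> R.
    by rewrite /prmb -expnM -mulnA natrX.
  have -> : (2 ^ prmmu p n)%:R = 2 ^+ (n * m) :> R by rewrite natrX.
  move=> sol.
  have -> : 2 ^+ (n * r) / 2 ^+ (2 * (n * m)) = 2 ^+ (n * r) / (2 ^+ (n * m)) ^+ 2 :> R.
    by congr (_ / _); rewrite mulnC exprM.
  apply: (approx_sol_gap al al0 lam _ _ _ enum irr sol); apply: le_trans uN.
  rewrite le_eqVlt; apply/orP; left; apply/eqP.
  have -> : u n = A0 * (2 ^+ (n * r) * 2 ^+ (n * m)) ^+ 2.
    by rewrite /u -exprD -exprM mulnC mulnDr.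
  by rewrite /A0 /Q; ring.
have u0 n : 0 < u n by apply: mulr_gt0 => //; rewrite exprn_gt0.
have rm1 : (1 <= r + m)%N.
  by rewrite addn_gt0 /r muln_gt0 /prms addn1 /prmr addn_gt0 (leq_trans _ p9).
have un n : n%:R < u n.
  apply: (lt_le_trans (expr2n_gt n)).
  apply: (@le_trans _ _ (2 ^+ (2 * (n * (r + m))))); last by rewrite ler_peMl // exprn_ge0.
  rewrite ler_weXn2l ?ler1n //; apply: (@leq_trans (n * (r + m))); first by rewrite leq_pmulr.
  by rewrite leq_pmull.
pose q := 1 - e.
have q0 : 0 < q by rewrite /q; lra.
have qE : -1 + e = - q by rewrite /q; ring.
pose d0 := lam 1%N - lam 0%N.
have d00 : 0 < d0 by rewrite subr_gt0; have [inc _] := enum; exact: inc.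
pose D := A0 * 2 ^+ (2 * (r + m)).
have D0 : 0 < D by apply: mulr_gt0 => //; rewrite exprn_gt0.
pose C1 := 4 * Q * D `^ q.
(* For [N] below [u n0] the first gap [d0] already bounds the minimum. *)
pose C2 := d0 * u n0 `^ q.
have Q0 : 0 < Q by exact: lt_le_trans Q1.
have C1_gt0 : 0 < C1 by rewrite !mulr_gt0 ?powR_gt0.
have C2_gt0 : 0 < C2 by rewrite mulr_gt0 ?powR_gt0.
exists (C1 + C2); split=> [|N N2]; first exact: addr_gt0.
have NR : 0 < N%:R :> R by rewrite ltr0n (leq_trans _ N2).
rewrite qE powRN; set NQ := N%:R `^ q.
have NQ0 : 0 < NQ by rewrite powR_gt0.
rewrite ler_pdivlMr //.
have [Nn0|n0N] := ltP N%:R (u n0).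
  apply: (@le_trans _ _ C2); last by rewrite lerDr ltW.
  apply: (@le_trans _ _ (d0 * NQ)).
    by rewrite ler_wpM2r ?(ltW NQ0) // delta_min_le0.
  rewrite ler_wpM2l ?(ltW d00) //.
  by apply: ge0_ler_powR; rewrite ?nnegrE ?(ltW q0) ?(ltW NR) ?(ltW (u0 _)) ?(ltW Nn0).
have ex : exists n, N%:R < u n by exists N; exact: un.
case: (ex_minnP ex) => n1 hn1 minn1.
have n01 : (n0 < n1)%N.
  rewrite ltnNge; apply/negP => n10.
  have : u n1 <= u n0.
    rewrite /u (ler_pM2l A00).
    by rewrite ler_weXn2l ?ler1n // leq_mul2l leq_mul2r n10 orbT.
  by rewrite leNgt (le_lt_trans n0N).
case: n1 n01 hn1 minn1 => // n n01 hn1 minn1.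
have uN : u n <= N%:R by rewrite leNgt; apply/negP => /minn1; rewrite ltnn.
have dN := step n N n01 uN.
apply: (@le_trans _ _ C1); last by rewrite lerDl ltW.
have uS : u n.+1 = D * 2 ^+ (2 * (n * (r + m))).
  rewrite /u /D (_ : 2 * (n.+1 * (r + m)) = 2 * (r + m) + 2 * (n * (r + m)))%N.
    by rewrite exprD mulrA.
  by rewrite -mulnDr -mulSn.
have NQu : NQ <= D `^ q * (2 ^+ (2 * (n * (r + m)))) `^ q.
  rewrite -powRM ?(ltW D0) ?exprn_ge0 // -uS.
  by apply: ge0_ler_powR; rewrite ?nnegrE ?(ltW q0) ?(ltW NR) ?(ltW (u0 _)) ?(ltW hn1).
have key : 2 ^+ (n * r) / 2 ^+ (2 * (n * m)) * (2 ^+ (2 * (n * (r + m)))) `^ q <= 1.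
  rewrite mulrAC ler_pdivrMr ?exprn_gt0 // mul1r.
  rewrite -!powR_mulrn // -powRrM -powRD; last by rewrite pnatr_eq0 implybT.
  apply: ler_powR; first by rewrite ler1n.
  have -> : (n * r)%:R + (2 * (n * (r + m)))%:R * q = n%:R * (r%:R + 2 * (r%:R + m%:R) * (1 - e)) :> R.
    by rewrite (natrM _ n r) (natrM _ 2) (natrM _ n (r + m)) natrD /q; ring.
  by rewrite mulnCA natrM ler_wpM2l // natrM.
apply: (@le_trans _ _ (4 * (Q * (2 ^+ (n * r) / 2 ^+ (2 * (n * m)))) * (D `^ q * (2 ^+ (2 * (n * (r + m)))) `^ q))).
  apply: (@le_trans _ _ (4 * (Q * (2 ^+ (n * r) / 2 ^+ (2 * (n * m)))) * NQ)).
    by rewrite ler_wpM2r ?(ltW NQ0).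
  by apply: ler_wpM2l NQu; rewrite !mulr_ge0 ?invr_ge0 ?exprn_ge0 ?(ltW Q0).
have -> : 4 * (Q * (2 ^+ (n * r) / 2 ^+ (2 * (n * m)))) * (D `^ q * (2 ^+ (2 * (n * (r + m)))) `^ q)
  = C1 * (2 ^+ (n * r) / 2 ^+ (2 * (n * m)) * (2 ^+ (2 * (n * (r + m)))) `^ q) by rewrite /C1; ring.
by rewrite ler_piMr ?(ltW C1_gt0).
Qed.

End Final.

Theorem theorem1p2 (R : realType) :
  {ae (@lebesgue_measure R), forall alpha : R,
     0 < alpha -> irrational alpha ->
     exists lam : nat -> R, increasing_enum alpha lam /\
       forall eps : R, 0 < eps ->
         exists C : R, 0 < C /\
           forall N : nat, (2 <= N)%N ->
             delta_min lam N <= C * (N%:R `^ (-1 + eps))}.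
Proof.
(* The boolean of [dyadic] is coded by the parity of [t], so that the exceptional set is a countable
   union over naturals. *)
have h : {ae (@lebesgue_measure R), forall alpha : R, forall p k t : nat,
  (9 <= p)%N -> dyadic (odd t) k <= alpha < 2 * dyadic (odd t) k ->
    exists n0, forall n, (n0 <= n)%N -> good_scale p (alpha / dyadic (odd t) k) n}.
  apply: ae_forall_nat => p; apply: ae_forall_nat => k; apply: ae_forall_nat => t.
  have [p9|p9] := boolP (9 <= p)%N; last first.
    by apply: (ae_impl (fun=> True)) => //; exact: aeW.
  by apply: (ae_impl _ _ _ (ae_good_scale p _ p9 (dyadic_gt0 (odd t) k))) => al h _.
apply: ae_impl h => al good al0 irr.
have [lam enum] := exists_enum al al0.
exists lam; split=> // eps eps0.
(* Keeps the exponent [1 - e] positive; a smaller [e] gives a stronger bound because [N >= 1]. *)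
pose e := Num.min eps 2^-1.
have e01 : 0 < e < 1.
  by rewrite lt_min eps0 /= invr_gt0 ltr0n /= gt_min; apply/orP; right; lra.
have goodb p : (9 <= p)%N -> forall s k, dyadic s k <= al < 2 * dyadic s k ->
    exists n0, forall n, (n0 <= n)%N -> good_scale p (al / dyadic s k) n.
  by move=> p9 s k; have := good p k s p9; case: s.
have [C [C0 hC]] := delta_min_bound lam al e al0 irr enum e01 goodb.
exists C; split=> // N N2; apply: (le_trans (hC N N2)); rewrite ler_wpM2l ?(ltW C0) //.
apply: ler_powR; first by rewrite ler1n ltnW.
by rewrite lerD2l ge_min lexx.
Qed.
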